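(* Let $q$ be a prime power, let $m\geq 4$ be an integer, $n=q^m-1$, $h=\lfloor m/2\rfloor$, and let $\delta \in \left[2, q^{\lfloor (2m-1)/3\rfloor +1}\right]$ be an integer. Let $N$, $f$, $\widetilde f$, $g$ be the functions defined in the context. (i) If $m$ is odd, then $$\dim(\mathcal{C}_{(q,m,\delta)})=n-m\left[N(\delta)-f(\delta)\right].$$ (ii) If $m$ is even, then $$\dim(\mathcal{C}_{(q,m,\delta)})=n-m\left[N(\delta)-\widetilde{f}(\delta)\right]-\frac{m}{2}\,g(\delta).$$
   Context: **BCH codes.** Let $\alpha$ be a primitive element of $\mathbb{F}_{q^m}$, $n=q^m-1$, and for an integer $i$ let $m_i(x)$ be the minimal polynomial of $\alpha^i$ over $\mathbb{F}_q$. For an integer $2\le\delta\le n$, $\mathcal{C}_{(q,m,\delta)}$ is the (narrow-sense primitive BCH) cyclic code of length $n$ over $\mathbb{F}_q$, i.e. the ideal of $\mathbb{F}_q[x]/(x^n-1)$, generated by $\mathrm{lcm}(m_1(x),m_2(x),\ldots,m_{\delta-1}(x))$; $\dim$ is the dimension over $\mathbb{F}_q$. **Notation.** For a real number $a$, $N(a)=\lfloor a-1\rfloor-\lfloor (a-1)/q\rfloor$. For an integer $\delta\in[2,q^{\lfloor (2m-1)/3\rfloor+1}]$ put $k_\delta=\lfloor\log_q(\delta-1)\rfloor-h$, so $q^{h+k_\delta}\le\delta-1<q^{h+k_\delta+1}$, and let $\sum_{\ell=0}^{h+k_\delta}\delta_\ell q^\ell$ be the $q$-adic expansion of $\delta-1$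 (digits $0\le\delta_\ell\le q-1$). If $k_\delta\ge m-2h$, let $s_\delta$ be the smallest integer in $[m-2h-k_\delta,k_\delta]$ with $\delta_{h+s_\delta}>0$, and for an integer $i$ let $$\mathcal{T}_i(\delta)=\Big\{t\in\mathbb{Z}: q^{k_\delta-i}\le t<\sum_{\ell=h+s_\delta}^{h+k_\delta}\delta_\ell q^{\ell-h-i},\ q\nmid t\Big\}.$$ **$m$ odd.** With $\mu(\delta)=\min\Big\{\sum_{\ell=0}^{h-k_\delta}\delta_\ell q^\ell,\ \sum_{\ell=h-s_\delta+1}^{h+k_\delta}\delta_\ell q^{\ell-(h-s_\delta+1)}\Big\}$, define $f(\delta)=0$ if $\delta\le q^{h+1}$, and if $\delta>q^{h+1}$, $$f(\delta)=q^{2k_\delta-3}(k_\delta-1)(q-1)^2+N(\mu(\delta)+1)+\sum_{i=-k_\delta+1}^{k_\delta}\ \sum_{t\in\mathcal{T}_i(\delta)}N(tq^{2i-1}+1).$$ **$m$ even.** With $\widetilde\mu(\delta)=\min\Big\{\sum_{\ell=0}^{h-k_\delta-1}\delta_\ell q^\ell,\ \sum_{\ell=h-s_\delta}^{h+k_\delta}\delta_\ell q^{\ell-(h-s_\delta)}\Big\}$, define $\widetilde f(\delta)=0$ if $\delta\le q^h$; $\widetilde f(\delta)=\frac12(\delta_h-1)\delta_h+N(\widetilde\mu(\delta)+1)$ if $q^h<\delta\le q^{h+1}$; and if $\delta>q^{h+1}$, $$\widetilde f(\delta)=\big(k_\delta-\tfrac12\big)q^{2k_\delta-2}(q-1)^2+\tfrac12q^{k_\delta-1}(q-1)+N(\widetilde\mu(\delta)+1)+\sum_{i=-k_\delta}^{k_\delta}\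 \sum_{t\in\mathcal{T}_i(\delta)}N(tq^{2i}+1).$$ For $\delta>q^h$ let $\tau(\delta)=1$ if $\delta_h>0$ and $\sum_{\ell=h}^{h+k_\delta}\delta_\ell q^{\ell-h}\le\sum_{\ell=0}^{h-1}\delta_\ell q^\ell$, and $\tau(\delta)=0$ otherwise. Define $g(\delta)=0$ if $\delta\le q^h$; $g(\delta)=\delta_h-1+\tau(\delta)$ if $q^h<\delta\le q^{h+1}$; and $g(\delta)=N\Big(\sum_{\ell=h}^{h+k_\delta}\delta_\ell q^{\ell-h}\Big)+\tau(\delta)$ if $\delta>q^{h+1}$. *)

(* Defs.v *)
From HB Require Import structures.
From mathcomp Require Import all_boot all_order all_algebra all_field.
From mathcomp Require Import zify.

Set Implicit Arguments.
Unset Strict Implicit.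
Unset Printing Implicit Defensive.

Import Order.TTheory GRing.Theory Num.Theory.
Local Open Scope ring_scope.

(* Not normalised to be monic: as for gcdp, an lcm is only determined up to a
   nonzero scalar, which does not affect the ideal it generates. *)
Definition lcmp (F : fieldType) (p r : {poly F}) : {poly F} :=
  p * r %/ gcdp p r.

Lemma dvdp_lcm (F : fieldType) (d p r : {poly F}) :
  (lcmp p r %| d) = (p %| d) && (r %| d).
Proof.
rewrite /lcmp; have [/eqP g0|g0] := boolP (gcdp p r == 0).
  move/eqP: (g0); rewrite gcdp_eq0 => /andP[/eqP-> /eqP->].
  by rewrite mul0r div0p andbb.
have Ep : p %/ gcdp p r * gcdp p r = p by rewrite divpK // dvdp_gcdl.
have Er : r %/ gcdp p r * gcdp p r = r by rewrite divpK // dvdp_gcdr.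
have cpr : coprimep (p %/ gcdp p r) (r %/ gcdp p r).
  apply: coprimep_div_gcd; apply: contraNT g0; rewrite negb_or !negbK.
  by move=> /andP[/eqP-> /eqP->]; rewrite gcd0p.
move: (gcdp p r) (p %/ _) (r %/ _) g0 Ep Er cpr => g p' r' g0 <- <- cpr.
have -> : p' * g * (r' * g) %/ g = p' * r' * g.
  by rewrite mulrA mulpK // mulrAC.
apply/idP/andP => [H|[]].
  split; apply: dvdp_trans H.
    by rewrite dvdp_mul2r // dvdp_mulIl.
  by rewrite dvdp_mul2r // dvdp_mulIr.
have [gd|ngd] := boolP (g %| d); last first.
  by move/(dvdp_trans (dvdp_mulIr _ _)); rewrite (negPf ngd).
by rewrite -(divpK gd) !dvdp_mul2r // Gauss_dvdp // => -> ->.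
Qed.

Lemma minPolyF_subproof (F : fieldType) (L : fieldExtType F) (x : L) :
  exists p : {poly F}, map_poly (in_alg L) p == minPoly 1%AS x.
Proof.
have /polyOver1P[p Ep] := minPolyOver 1%AS x.
by exists p; rewrite Ep.
Qed.

(* The library's minPoly over the base field 1%AS = F * 1 is a polynomial over
   L; this is the same polynomial with coefficients in F. *)
Definition minPolyF (F : fieldType) (L : fieldExtType F) (x : L) : {poly F} :=
  xchoose (minPolyF_subproof x).

Lemma minPolyFE (F : fieldType) (L : fieldExtType F) (x : L) :
  map_poly (in_alg L) (minPolyF x) = minPoly 1%AS x.
Proof. exact/eqP/(xchooseP (minPolyF_subproof x)). Qed.

Definition bch_gen (F : fieldType) (L : fieldExtType F) (alpha : L)
    (delta : nat) : {poly F} :=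
  \big[@lcmp F/1]_(1 <= i < delta) minPolyF (alpha ^+ i).

(* {poly %/ p} silently quotients by 'X when p is not monic of size > 1. *)
Lemma mk_monic_XnsubC1 (F : fieldType) (n : nat) : (0 < n)%N ->
  mk_monic ('X^n - 1 : {poly F}) = 'X^n - 1.
Proof.
by move=> n0; rewrite /mk_monic size_XnsubC // ltnS n0 monicXnsubC.
Qed.

(* The ideal generated by bch_gen, as an F-subspace; see mem_bch_code. *)
Definition bch_code (F : fieldType) (L : fieldExtType F) (alpha : L)
    (n delta : nat) : {vspace {poly %/ ('X^n - 1 : {poly F})}} :=
  limg (linfun (in_qpoly ('X^n - 1) (bch_gen alpha delta) \*o idfun)).

Lemma mem_bch_code (F : fieldType) (L : fieldExtType F) (alpha : L)
    (n delta : nat) (c : {poly %/ ('X^n - 1 : {poly F})}) :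
  reflect (exists u, c = in_qpoly ('X^n - 1) (bch_gen alpha delta) * u)
          (c \in bch_code alpha n delta).
Proof.
apply: (iffP memv_imgP) => [[u _ ->]|[u ->]]; exists u;
  rewrite ?lfunE ?memvf //.
Qed.

Definition zrange (a b : int) : seq int :=
  if a <= b then [seq a + i%:Z | i <- iota 0 `|b - a|%N.+1] else [::].

Lemma mem_zrange (a b x : int) : (x \in zrange a b) = (a <= x <= b).
Proof.
rewrite /zrange; case: ifP => ab; last first.
  by apply/esym/negP => /andP[/le_trans H /H]; rewrite ab.
apply/mapP/andP => [[i]|[ax xb]].
  by rewrite mem_iota => ib ->; lia.
by exists `|x - a|%N; [rewrite mem_iota|]; lia.
Qed.

Lemma zrange_uniq (a b : int) : uniq (zrange a b).
Proof.
rewrite /zrange; case: ifP => // _; rewrite map_inj_uniq ?iota_uniq //.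
by move=> i j /addrI[].
Qed.

Lemma zrange_sorted (a b : int) : sorted <%R (zrange a b).
Proof.
rewrite /zrange; case: ifP => // _; rewrite sorted_map.
apply: sub_sorted (iota_ltn_sorted 0 _) => i j /= ij.
by rewrite ltrD2l ltz_nat.
Qed.

Definition Nq (q : nat) (R : archiRealFieldType) (a : R) : int :=
  Num.floor (a - 1) - Num.floor ((a - 1) / q%:R).

Section Functions.

Variables q m delta : nat.

Definition hm : int := (m %/ 2)%:Z.

(* The digit delta_l of delta - 1 in base q; int-valued indices keep all range
   bounds free of truncated subtraction. *)
Definition digit (l : int) : nat :=
  if l is Posz j then (delta.-1 %/ q ^ j) %% q else 0%N.

(* floor(log_q(delta - 1)) - h, negative for small delta; see kdP. *)
Definition kd : int := (trunc_log q delta.-1)%:Z - hm.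

(* \sum_(l = a)^b delta_l q^(l - c); the exponents may be negative. *)
Definition dsum (a b c : int) : rat :=
  \sum_(l <- zrange a b) (digit l)%:R * q%:R ^ (l - c).

(* Only meaningful when m - 2 h <= kd, see sdP. *)
Definition sd : int :=
  head 0 [seq s <- zrange (m%:Z - 2 * hm - kd) kd | (0 < digit (hm + s))%N].

(* The range 1 .. ceil U only serves to make the set finite; see mem_Tset. *)
Definition Tset (i : int) : seq int :=
  let U := dsum (hm + sd) (hm + kd) (hm + i) in
  [seq t <- zrange 1 (Num.ceil U)
    | (q%:R ^ (kd - i) <= (t%:~R : rat) < U) && ~~ (q%:Z %| t)%Z].

Lemma mem_Tset (i t : int) : (0 < q)%N ->
  (t \in Tset i) =
  (q%:R ^ (kd - i) <= (t%:~R : rat) < dsum (hm + sd) (hm + kd) (hm + i))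
    && ~~ (q%:Z %| t)%Z.
Proof.
move=> q0; rewrite mem_filter mem_zrange.
apply: andb_idr => /andP[/andP[H1 H2] _].
apply/andP; split.
  rewrite -gtz0_ge1 -(ltr0z rat); apply: lt_le_trans H1.
  by rewrite exprz_gt0 // ltr0n.
by rewrite -(ler_int rat) (le_trans (ltW H2)) // ceil_ge.
Qed.

Lemma Tset_uniq (i : int) : uniq (Tset i).
Proof. exact/filter_uniq/zrange_uniq. Qed.

Definition mu_odd : rat :=
  Num.min (dsum 0 (hm - kd) 0) (dsum (hm - sd + 1) (hm + kd) (hm - sd + 1)).

Definition f_odd : rat :=
  if (delta <= q ^ (m %/ 2 + 1))%N then 0 else
  q%:R ^ (2 * kd - 3) * (kd - 1)%:~R * (q%:R - 1) ^+ 2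
  + (Nq q (mu_odd + 1))%:~R
  + \sum_(i <- zrange (- kd + 1) kd) \sum_(t <- Tset i)
      (Nq q (t%:~R * q%:R ^ (2 * i - 1) + 1 : rat))%:~R.

Definition mu_even : rat :=
  Num.min (dsum 0 (hm - kd - 1) 0) (dsum (hm - sd) (hm + kd) (hm - sd)).

Definition f_even : rat :=
  if (delta <= q ^ (m %/ 2))%N then 0 else
  if (delta <= q ^ (m %/ 2 + 1))%N then
    2^-1 * ((digit hm)%:R - 1) * (digit hm)%:R + (Nq q (mu_even + 1))%:~R
  else
  (kd%:~R - 2^-1) * q%:R ^ (2 * kd - 2) * (q%:R - 1) ^+ 2
  + 2^-1 * q%:R ^ (kd - 1) * (q%:R - 1)
  + (Nq q (mu_even + 1))%:~R
  + \sum_(i <- zrange (- kd) kd) \sum_(t <- Tset i)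
      (Nq q (t%:~R * q%:R ^ (2 * i) + 1 : rat))%:~R.

Definition tau : bool :=
  (0 < digit hm)%N && (dsum hm (hm + kd) hm <= dsum 0 (hm - 1) 0).

Definition g_even : rat :=
  if (delta <= q ^ (m %/ 2))%N then 0 else
  if (delta <= q ^ (m %/ 2 + 1))%N then (digit hm)%:R - 1 + tau%:R
  else (Nq q (dsum hm (hm + kd) hm))%:~R + tau%:R.

Lemma kdP : (1 < q)%N -> (1 < delta)%N ->
  q%:R ^ (hm + kd) <= (delta.-1)%:R :> rat
  /\ (delta.-1)%:R < q%:R ^ (hm + kd + 1) :> rat.
Proof.
move=> q1 d1; rewrite /kd addrC subrK.
have d0 : (0 < delta.-1)%N by case: (delta) d1 => [|[]].
have /andP[H1 H2] := trunc_log_bounds q1 d0.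
have -> : (trunc_log q delta.-1)%:Z + 1 = (trunc_log q delta.-1).+1%:Z.
  by rewrite -addn1 PoszD.
by rewrite -!exprnP -!natrX ler_nat ltr_nat.
Qed.

Lemma sdP : (1 < q)%N -> (1 < delta)%N -> m%:Z - 2 * hm <= kd ->
  [/\ m%:Z - 2 * hm - kd <= sd <= kd, (0 < digit (hm + sd))%N &
      forall s, m%:Z - 2 * hm - kd <= s <= kd -> (0 < digit (hm + s))%N ->
      sd <= s].
Proof.
move=> q1 d1 hk.
have d0 : (0 < delta.-1)%N by case: (delta) d1 => [|[]].
have k_dig : (0 < digit (hm + kd))%N.
  rewrite /kd addrC subrK /=; have /andP[H1 H2] := trunc_log_bounds q1 d0.
  by rewrite modn_small ?divn_gt0 ?ltn_divLR ?expn_gt0 ?(ltnW q1) // -expnS.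
have m2h_ge0 : 0 <= m%:Z - 2 * hm.
  by rewrite subr_ge0 /hm -PoszM lez_nat mulnC leq_divM.
have k_in : kd \in zrange (m%:Z - 2 * hm - kd) kd.
  rewrite mem_zrange lexx andbT lerBlDr (le_trans hk) // lerDl.
  exact: le_trans hk.
have E s : (s \in [seq s <- zrange (m%:Z - 2 * hm - kd) kd
                   | (0 < digit (hm + s))%N])
   = (0 < digit (hm + s))%N && (m%:Z - 2 * hm - kd <= s <= kd).
  by rewrite mem_filter mem_zrange.
have srt : sorted <%R [seq s <- zrange (m%:Z - 2 * hm - kd) kd
                   | (0 < digit (hm + s))%N].
  by apply: sorted_filter (zrange_sorted _ _); apply: lt_trans.
rewrite /sd; case: [seq _ <- _ | _] E srt => [|s0 r] E srt.
  by have := E kd; rewrite in_nil k_dig -mem_zrange k_in.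
have := E s0; rewrite mem_head => /esym/andP[-> ->]; split => // s sr sdig.
have := E s; rewrite sr sdig inE => /orP[/eqP->//|s_r].
by move: srt; rewrite /= lt_path_sortedE => /andP[/allP/(_ _ s_r)/ltW].
Qed.

End Functions.

(* Main.v *)
(* Write a = delta - 1, and let A be the set of x in [1, a] not divisible by q.
   The dimension is n - |U|, where U is the set of y < n some rotation
   y q^j mod n of which lies in A.  The upper bound on delta forces long runs of
   leading zeros on the elements of A, so each y has r(y) <= 2 rotations in A.
   Summing 2 [r > 0] = 3 r - r^2 over y gives 2 |U| = 2 m |A| - m |D|, where D is
   the set of (x, j), 0 < j < m, with x and its rotation by j both in A; sizes of
   cosets never enter.

   Splitting the word of x at j turns D into the set of triples (j, t, z), t and
   z not divisible by q, with t q^(m-j) + z <= a and z q^j + t <= a.  This is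
   symmetric under (j, t, z) -> (m-j, z, t), and the fixed triples (m even,
   j = m/2, t = z) are counted by g, so |D| = 2 f - g (with g = 0 for m odd),
   where f counts the triples with z q^j <= t q^(m-j).  With k = h + k_delta,
   these are sorted by p = t q^(m-j): p < q^k gives the closed form (by the same
   symmetry), q^k <= p < top gives the sum over the T_i, and p = top gives
   N(mu + 1), where top is a with its m - k lowest digits erased. *)

From HB Require Import structures.
Require Import Defs.
From mathcomp Require Import all_boot all_order all_algebra all_field.
From mathcomp Require Import zify ring.

Set Implicit Arguments.
Unset Strict Implicit.
Unset Printing Implicit Defensive.

Import Order.TTheory GRing.Theory Num.Theory.
Local Open Scope ring_scope.

(** * The dimension as a number of residues *)

Section Ideal.

Variable F : fieldType.

(** Multiplication by [g] maps the polynomials of size at most [n.+1 - size g] isomorphically onto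
    the ideal: the products have degree below [n], so they need no reduction, and every reduced
    element of the ideal is a multiple of [g] because [g] divides ['X^n - 1]. *)
Lemma dim_ideal (n : nat) (g : {poly F}) (V : {vspace {poly %/ ('X^n - 1 : {poly F})}}) :
  (0 < n)%N -> g %| 'X^n - 1 ->
  (forall c, reflect (exists u, c = in_qpoly ('X^n - 1) g * u) (c \in V)) ->
  (\dim V + (size g).-1 = n)%N.
Proof.
move=> n0 gdv VP.
have h0 : ('X^n - 1 : {poly F}) != 0 by rewrite -size_poly_gt0 size_XnsubC.
have g0 : g != 0 by apply: contraNneq h0 => gE; rewrite gE dvd0p in gdv.
have sg0 : (0 < size g)%N by rewrite size_poly_gt0.
have sg : (size g <= n.+1)%N by have := dvdp_leq h0 gdv; rewrite size_XnsubC.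
pose K := (n.+1 - size g)%N.
pose phi (v : {poly_K F}) : {poly %/ ('X^n - 1 : {poly F})} :=
  in_qpoly ('X^n - 1) (g * (v : {poly F})).
have phi_lin : linear phi.
  move=> a u v; rewrite /phi -in_qpolyZ -in_qpolyD; congr in_qpoly.
  by rewrite scalerAr -mulrDr.
pose phiL := GRing.isLinear.Build F _ _ _ phi phi_lin.
pose phiM : {linear {poly_K F} -> {poly %/ ('X^n - 1 : {poly F})}} :=
  HB.pack phi phiL.
have phiE v : phi v = g * (v : {poly F}) :> {poly F}.
  rewrite /phi in_qpoly_small // mk_monic_XnsubC1 // size_XnsubC // ltnS.
  have szM : (size (g * (v : {poly F}))%R <= (size g + size (v : {poly F})).-1)%N.
    by rewrite size_polyMleq.
  apply: leq_trans szM _; have : (size (v : {poly F}) <= K)%N := size_npoly v.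
  by rewrite /K; lia.
have imgP : limg (linfun phiM) = V.
  apply/vspaceP => c; apply/memv_imgP/VP => [[v _ ->]|[u ->]].
    by exists (in_qpoly _ (v : {poly F})); rewrite lfunE /= /phi in_qpolyM.
  pose r := in_qpoly ('X^n - 1) g * u.
  have gr : g %| (r : {poly F}).
    have -> : (r : {poly F}) = in_qpoly ('X^n - 1) (g * (u : {poly F})).
      have uE : in_qpoly ('X^n - 1) (u : {poly F}) = u.
        exact/val_inj/in_qpoly_small/size_mk_monic.
      by rewrite in_qpolyM uE.
    move: (u : {poly F}) => w.
    rewrite /= mk_monic_XnsubC1 // -Pdiv.IdomainMonic.modpE ?monicXnsubC //.
    by rewrite -dvdp_mod // dvdp_mulIl.
  rewrite -/r; move: r gr => r gr.
  have szr : (size (r : {poly F}) <= n)%N.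
    have := size_mk_monic r; move: (r : {poly F}) => p.
    by rewrite mk_monic_XnsubC1 // size_XnsubC.
  pose w := npolyp K ((r : {poly F}) %/ g).
  have wE : (w : {poly F}) = (r : {poly F}) %/ g.
    apply: npolypK; rewrite size_divp //.
    apply: leq_trans (leq_sub2r _ szr) _.
    by rewrite -subn1 /K; move: (size g) sg0 => sz; lia.
  have phiw : phi w = r.
    by apply: val_inj; apply: etrans (phiE w) _; rewrite wE mulrC divpK.
  exists w; first exact: memvf.
  by rewrite lfunE /= phiw.
have kerP : lker (linfun phiM) == 0%VS.
  apply/lker0P => u v; rewrite !lfunE /= => uv; apply/val_inj.
  by apply: (mulfI g0); rewrite -!phiE uv.
rewrite -imgP limg_dim_eq; first by rewrite dim_polyn /K; lia.
by rewrite (eqP kerP) capv0.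
Qed.

End Ideal.

Section Generator.

Variables (F : fieldType) (L : fieldExtType F).

Lemma dvdp_minPolyF (x : L) (d : {poly F}) :
  (minPolyF x %| d) = root (map_poly (in_alg L) d) x.
Proof.
rewrite -(dvdp_map (in_alg L)) minPolyFE; apply/idP/idP => [dv|].
  by move: (root_minPoly 1%AS x); rewrite -!dvdp_XsubCl => /dvdp_trans; apply.
by apply: minPoly_dvdp; apply/polyOver1P; exists d.
Qed.

Lemma dvdp_bch_gen (alpha : L) delta (d : {poly F}) :
  (bch_gen alpha delta %| d) =
  all (fun i => root (map_poly (in_alg L) d) (alpha ^+ i)) (index_iota 1 delta).
Proof.
rewrite /bch_gen unlock /=.
elim: (index_iota 1 delta) => [|i s IHs] /=; first by rewrite dvd1p.
by rewrite dvdp_lcm dvdp_minPolyF IHs.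
Qed.

End Generator.

(** * The Frobenius map over the base field *)

Section Frobenius.

Variables (F : finFieldType) (L : fieldExtType F).

Definition frob (x : L) : L := x ^+ #|F|.

Lemma pchar_nat_card : [pchar L].-nat #|F|.
Proof.
have [p p_pr pF] := finPcharP F.
rewrite (card_pprimeChar pF) pnatX; apply/orP; left.
by rewrite pnatE // pchar_lalg.
Qed.

Lemma frob_is_zmod_morphism : zmod_morphism frob.
Proof.
have frobD x y : frob (x + y) = frob x + frob y := exprDn_pchar x y pchar_nat_card.
move=> x y; apply: (addIr (frob y)).
by rewrite -frobD !subrK.
Qed.

Lemma frob_is_monoid_morphism : monoid_morphism frob.
Proof. by split=> [|x y]; rewrite /frob ?expr1n ?exprMn. Qed.

HB.instance Definition _ :=
  GRing.isZmodMorphism.Build L L frob frob_is_zmod_morphism.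
HB.instance Definition _ :=
  GRing.isMonoidMorphism.Build L L frob frob_is_monoid_morphism.

(** This is Fermat's little theorem for the subfield [1%AS], which has dimension 1 and hence [#|F|]
    elements. *)
Lemma frob_fix (x : L) : frob x = x -> x \in 1%VS.
Proof.
move=> fx; have := @Fermat's_little_theorem _ L 1%AS x; rewrite dimv1 expn1 => ->.
exact/eqP.
Qed.

Lemma frob_in_alg (a : F) : frob (in_alg L a) = in_alg L a.
Proof. by rewrite /frob -rmorphXn /= expf_card. Qed.

Lemma root_frob (p : {poly F}) (x : L) j :
  root (map_poly (in_alg L) p) (x ^+ (#|F| ^ j)) = root (map_poly (in_alg L) p) x.
Proof.
have root1 y : root (map_poly (in_alg L) p) (frob y) =
               root (map_poly (in_alg L) p) y.
  rewrite -[RHS](fmorph_root frob) -map_poly_comp.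
  by congr (root _ _); apply: eq_map_poly => a /=; rewrite frob_in_alg.
elim: j => [|j IHj]; first by rewrite expn0 expr1.
by rewrite expnSr exprM [LHS]root1.
Qed.

End Frobenius.

(** * The degree of the generator *)

Section Dimension.

Variables (F : finFieldType) (L : fieldExtType F).

(** The hypotheses say that [P] is the union of the orbits of [1, ..., delta - 1] under
    multiplication by [#|F|]. The product of the ['X - alpha ^+ y] over [P] is stable under
    Frobenius, so it descends to [F]; it is associate to the generator, whose degree is therefore
    the size of [P]. *)
Lemma dim_bch_code (alpha : L) (n delta : nat) (P : pred nat) :
  n.-primitive_root alpha ->
  (forall y, (y < n)%N -> P y -> P ((y * #|F|) %% n)%N) ->
  (forall i, (1 <= i < delta)%N -> P (i %% n)%N) ->
  (forall y, (y < n)%N -> P y -> exists i j,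
     (1 <= i < delta)%N /\ (y * #|F| ^ j = i %[mod n])%N) ->
  (\dim (bch_code alpha n delta) + #|[set y : 'I_n | P y]| = n)%N.
Proof.
move=> prim P_mul P_id P_ex; have n0 := prim_order_gt0 prim.
set g := bch_gen alpha delta.
pose S := [seq alpha ^+ val y | y <- enum [set y : 'I_n | P y]].
pose G : {poly L} := \prod_(z <- S) ('X - z%:P).
have S_uniq : uniq S.
  rewrite map_inj_in_uniq ?enum_uniq // => y z _ _ /eqP.
  by rewrite (eq_prim_root_expr prim) !modn_small ?ltn_ord // => /eqP/val_inj.
have memS e : P (e %% n)%N -> alpha ^+ e \in S.
  move=> Pe; apply/mapP; exists (Ordinal (ltn_pmod e n0)).
    by rewrite mem_enum inE.
  by rewrite /= (prim_expr_mod prim).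
have frobG : map_poly (@frob F L) G = G.
  rewrite /G rmorph_prod /=; under eq_bigr do rewrite map_polyXsubC.
  rewrite -(big_map (@frob F L) xpredT (fun z => 'X - z%:P)).
  have frobS_uniq : uniq [seq frob z | z <- S].
    by rewrite map_inj_uniq //; apply: fmorph_inj.
  apply: perm_big; apply: uniq_perm => //.
  (* The image of [S] lies in [S] and has as many elements, so it is all of [S]. *)
  apply: (uniq_min_size frobS_uniq _ _).2; rewrite ?size_map //.
  move=> _ /mapP[_ /mapP[y + ->] ->]; rewrite mem_enum inE => Py.
  by rewrite /frob -exprM memS // P_mul ?ltn_ord.
have [G0 G0E] : exists G0, G = map_poly (in_alg L) G0.
  apply/polyOver1P/polyOverP => i.
  by apply: frob_fix; rewrite -[in RHS]frobG coef_map.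
have gG0 : g %| G0.
  rewrite dvdp_bch_gen; apply/allP => i; rewrite mem_index_iota => hi.
  by rewrite -G0E root_prod_XsubC memS ?P_id.
have groot z : z \in S -> root (map_poly (in_alg L) g) z.
  move=> /mapP[y + ->]; rewrite mem_enum inE => Py.
  have [i [j [hi /eqP hj]]] := P_ex y (ltn_ord y) Py.
  rewrite -(@root_frob F L g _ j) -exprM.
  move: hj; rewrite -(eq_prim_root_expr prim) => /eqP->.
  have := dvdpp g; rewrite {1}/g dvdp_bch_gen => /allP; apply.
  by rewrite mem_index_iota.
have Gg : G %| map_poly (in_alg L) g.
  apply: uniq_roots_dvdp; last by rewrite uniq_rootsE.
  by apply/allP.
have G0dv : G0 %| 'X^n - 1.
  rewrite -(dvdp_map (in_alg L)) -G0E rmorphB /= map_polyXn rmorph1.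
  apply: uniq_roots_dvdp; last by rewrite uniq_rootsE.
  apply/allP => _ /mapP[y _ ->].
  by rewrite rootE !hornerE -exprM mulnC exprM (prim_expr_order prim) expr1n subrr.
have -> : #|[set y : 'I_n | P y]| = (size g).-1.
  have -> : size g = size G0.
    by apply: eqp_size; rewrite /eqp gG0 -(dvdp_map (in_alg L)) -G0E.
  by rewrite -(size_map_poly (in_alg L)) -G0E size_prod_XsubC size_map -cardE.
apply: dim_ideal => //; first exact: dvdp_trans gG0 G0dv.
by move=> c; apply: mem_bch_code.
Qed.

End Dimension.

(** * Orbits meeting a sparse set *)

Section OrbitCount.

Local Open Scope nat_scope.

(* With r y the number of hits of the orbit of y, this is the sum over y of the
   identity 2 * (0 < r) + r ^ 2 = 3 * r, valid for r <= 2. *)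
Lemma orbit_count (T : finType) (s : T -> T) (m : nat) (A : pred T) :
  0 < m -> (forall y, iter m s y = y) ->
  (forall y, \sum_(j < m) A (iter j s y) <= 2) ->
  2 * #|[set y | [exists j : 'I_m, A (iter j s y)]]|
    + m * \sum_(1 <= d < m) \sum_y (A y && A (iter d s y))
  = 2 * m * \sum_y A y.
Proof.
move=> m0 sm r2; pose r y := \sum_(j < m) A (iter j s y).
have s_inj : injective s.
  by apply: (can_inj (g := iter m.-1 s)) => y; rewrite -iterSr prednK.
have shift (f : T -> nat) j : \sum_y f (iter j s y) = \sum_y f y.
  rewrite [RHS](reindex_inj (h := iter j s)) //.
  by elim: j => // j IHj x y /s_inj; apply: IHj.
have rS y : r (s y) = r y.
  rewrite /r -(prednK m0) big_ord_recr [RHS]big_ord_recl /= addnC -iterSr prednK //.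
  by rewrite sm; congr (_ + _); apply: eq_bigr => i _; rewrite -iterSr.
have r_iter j y : r (iter j s y) = r y.
  by elim: j => //= j IHj; rewrite rS.
have sum_r : \sum_y r y = m * \sum_y A y.
  rewrite exchange_big /=; under eq_bigr => j _ do rewrite (shift (fun y => A y : nat)).
  by rewrite sum_nat_const card_ord.
(* The term [j = 0] of [r y] gives [A y] itself; the others give the pairs at distance [d]. *)
have sum_Ar : \sum_y A y * r y =
    \sum_y A y + \sum_(1 <= d < m) \sum_y (A y && A (iter d s y)).
  rewrite exchange_big /= -big_split /=; apply: eq_bigr => y _.
  rewrite /r big_distrr /= -(big_mkord xpredT (fun j => A y * A (iter j s y))).
  rewrite big_ltn //= mulnb andbb; congr (_ + _).
  by apply: eq_bigr => j _; rewrite mulnb.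
(* [r] is constant on orbits, so each of the [m] shifts of the summand can be undone. *)
have sum_rr : \sum_y r y * r y = m * \sum_y A y * r y.
  transitivity (\sum_y \sum_(j < m) A (iter j s y) * r (iter j s y)).
    apply: eq_bigr => y _; rewrite {1}/r big_distrl /=.
    by apply: eq_bigr => j _; rewrite r_iter.
  rewrite exchange_big /=.
  under eq_bigr => j _ do rewrite (shift (fun y => A y * r y)).
  by rewrite sum_nat_const card_ord.
have cardU : #|[set y | [exists j : 'I_m, A (iter j s y)]]| = \sum_y (0 < r y).
  rewrite -sum1_card big_mkcond /=; apply: eq_bigr => y _; rewrite inE.
  suff -> : [exists j : 'I_m, A (iter j s y)] = (0 < r y) by case: (0 < r y).
  rewrite lt0n /r sum_nat_eq0 negb_forall; apply/existsP/existsP.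
    by move=> [j Aj]; exists j; rewrite Aj.
  by move=> [j]; case Aj: (A _) => // _; exists j.
have key : 2 * \sum_y (0 < r y) + \sum_y r y * r y = 3 * \sum_y r y.
  rewrite !big_distrr -big_split /=; apply: eq_bigr => y _.
  by have := r2 y; rewrite -/(r y); case: (r y) => [|[|[|]]].
by rewrite cardU; move: key; rewrite sum_rr sum_Ar sum_r; nia.
Qed.

(** Three hits [x < y < z] would give [2 * b <= z - x] by adding two gaps, but also
    [z - x <= m - b]. *)
Lemma sparse_sum_le2 (m b : nat) (J : pred nat) : m < 3 * b ->
  (forall i j, i < j < m -> J i -> J j -> b <= j - i <= m - b) ->
  \sum_(j < m) J j <= 2.
Proof.
move=> mb sparse; rewrite -(big_mkord xpredT (fun j => J j : nat)) -big_mkcond /=.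
rewrite sum1_count -size_filter.
set l := [seq _ <- _ | _].
have : sorted ltn l by apply: sorted_filter (iota_ltn_sorted _ _); apply: ltn_trans.
have : all (fun j => J j && (j < m)) l.
  by apply/allP => j; rewrite mem_filter mem_index_iota => /andP[->].
case: l => [|x [|y [|z l]]] //= /and4P[/andP[Jx _] /andP[Jy ym] /andP[Jz zm] _].
move=> /and3P[xy yz _].
have := sparse x y; have := sparse y z; have := sparse x z.
by rewrite Jx Jy Jz; lia.
Qed.

End OrbitCount.

(** * Counting nonmultiples and comparing multiples *)

Section Arithmetic.

Local Open Scope nat_scope.

Lemma sum_widen (f : nat -> nat) (M N : nat) : M <= N ->
  (forall x, M <= x -> f x = 0) -> \sum_(0 <= x < N) f x = \sum_(0 <= x < M) f x.
Proof.
move=> MN f0; rewrite (big_cat_nat (n := M)) //= [X in _ + X]big1_seq ?addn0 //.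
by move=> x; rewrite mem_index_iota => /andP[_ /andP[+ _]]; apply: f0.
Qed.

Lemma sum_nondvd (q M x : nat) : x < M ->
  \sum_(0 <= z < M) (~~ (q %| z) && (z <= x)) = x - x %/ q.
Proof.
move=> xM; rewrite (@sum_widen _ x.+1) //; last first.
  by move=> z zx; rewrite [z <= x]leqNgt zx andbF.
rewrite divn_count_dvd big_ltn // dvdn0 add0n.
apply/eqP; rewrite -(eqn_add2r (\sum_(1 <= i < x.+1) (q %| i))) subnK; last first.
  by rewrite -divn_count_dvd leq_div.
rewrite -big_split /= (eq_big_nat _ _ (F2 := fun=> 1)).
  by rewrite sum_nat_const_nat; lia.
by move=> z /andP[_ zx]; rewrite -[z <= x]ltnS zx andbT; case: (q %| z).
Qed.

Lemma sum_pred1 (M x : nat) (P : pred nat) : x < M ->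
  \sum_(0 <= z < M) ((z == x) && P z) = P x.
Proof.
move=> xM; rewrite (bigD1_seq x) ?mem_index_iota ?iota_uniq //= eqxx /=.
by rewrite big1 ?addn0 // => z /negPf->.
Qed.

Lemma sum_interval (m n u v : nat) : m <= u -> v <= n ->
  \sum_(m <= j < n) (u <= j < v) = v - u.
Proof.
move=> mu vn; have <- : \sum_(u <= j < v) 1 = v - u by rewrite sum_nat_const_nat muln1.
rewrite [RHS](big_nat_widen _ _ n) // [RHS](big_nat_widenl _ m) // [RHS]big_mkcond /=.
by apply: eq_bigr => j _; rewrite andbC; case: (_ && _).
Qed.

Lemma dvdn_gap (d x y : nat) : d %| x -> d %| y -> x < y -> x + d <= y.
Proof.
move=> dx dy xy; have /dvdn_leq : d %| y - x by apply: dvdn_sub.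
by rewrite subn_gt0 => /(_ xy); lia.
Qed.

(** If the exponents differed, [q] would divide the cofactor of the smaller power. *)
Lemma expn_factor_inj (q i l x y : nat) : 1 < q ->
  ~~ (q %| x) -> ~~ (q %| y) -> x * q ^ i = y * q ^ l -> i = l.
Proof.
move=> q1; have aux i' l' x' y' : i' < l' -> ~~ (q %| x') ->
    x' * q ^ i' <> y' * q ^ l'.
  move=> il nx /eqP; rewrite -(subnK (ltnW il)) expnD mulnA.
  rewrite eqn_pmul2r ?expn_gt0 ?(ltnW q1) // => /eqP xE; case/negP: nx.
  by rewrite xE dvdn_mull // dvdn_exp // subn_gt0.
move=> nx ny E; case: (ltngtP i l) => // h; first by case: (aux _ _ _ _ h nx E).
by case: (aux _ _ _ _ h ny (esym E)).
Qed.

End Arithmetic.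

(** * Rotations of words of length [m] with values up to [a] *)

Section Cosets.

Local Open Scope nat_scope.

Variables (q m a k : nat).
Hypotheses (q1 : 1 < q) (a_ge : q ^ k <= a) (a_lt : a < q ^ k.+1).
Hypotheses (m_gt2 : 2 < m) (k_small : 3 * k + 1 <= 2 * m).

Local Notation n := (q ^ m - 1).

Definition in_range x := ~~ (q %| x) && (x <= a).

Definition meets_range y := [exists j : 'I_m, in_range ((y * q ^ j) %% n)].

(** [t] and [z] share one bound, the same for every [j], so that the symmetry can exchange the
    sums. *)
Definition shift_sum (P : nat -> nat -> nat -> bool) :=
  \sum_(1 <= j < m) \sum_(0 <= t < q ^ m) \sum_(0 <= z < q ^ m) P j t z.

(* The word of x is the concatenation of those of t and z; rotating it by j
   places exchanges the two factors. *)
Definition split_pair j t z :=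
  [&& ~~ (q %| t), ~~ (q %| z), t * q ^ (m - j) + z <= a & z * q ^ j + t <= a].

Lemma a_lt_n : a < n.
Proof.
have : q ^ k.+1 < q ^ m by rewrite ltn_exp2l //; lia.
by lia.
Qed.

(** As [q ^ m] is 1 modulo [n], the [j] leading digits of [x] wrap around to the low end. *)
Lemma rot_modE x j : j <= m -> x < n ->
  (x * q ^ j) %% n = x %% q ^ (m - j) * q ^ j + x %/ q ^ (m - j).
Proof.
move=> jm xn.
have qm : q ^ m = q ^ (m - j) * q ^ j by rewrite -expnD subnK.
have ql : 0 < q ^ (m - j) by rewrite expn_gt0; lia.
have qj : 0 < q ^ j by rewrite expn_gt0; lia.
have lt1 : x %% q ^ (m - j) < q ^ (m - j) by rewrite ltn_mod.
have lt2 : x %/ q ^ (m - j) < q ^ j by rewrite ltn_divLR // mulnC -qm; lia.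
have E := divn_eq x (q ^ (m - j)).
move: lt1 lt2 E; set X := x %/ _; set Y := x %% _ => lt1 lt2 E.
have {1}-> : x * q ^ j = X * n + (Y * q ^ j + X).
  rewrite [in LHS]E mulnDl -mulnA -qm mulnBr muln1.
  by have := leq_pmulr X (n := q ^ m); nia.
rewrite modnMDl modn_small //.
have : Y * q ^ j + X <= n by rewrite qm; nia.
(* The value [n] has all its digits equal to [q - 1], so it could only come from [x = n]. *)
rewrite leq_eqVlt => /orP[/eqP En|//]; exfalso.
move: En xn; rewrite E qm {E}; move: lt1 lt2 ql qj.
move: (X) (Y) (q ^ (m - j)) (q ^ j) => {}X {}Y A B YA XB A0 B0 En xn.
have YB : Y.+1 * B <= A * B by rewrite leq_mul2r YA orbT.
have XA : X.+1 * A <= B * A by rewrite leq_mul2r XB orbT.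
have X1 : X.+1 = B by rewrite mulSn in YB; lia.
have Y1 : Y.+1 = A by apply/eqP; rewrite -(eqn_pmul2r B0); apply/eqP; rewrite mulSn; lia.
by move: xn; rewrite -X1 -Y1 !mulSn !mulnS; lia.
Qed.

Lemma expq_mod i : q ^ (i + m) = q ^ i %[mod n].
Proof.
have q0 : 0 < q ^ m by rewrite expn_gt0; lia.
by rewrite expnD -{1}(subnK q0) mulnDr muln1 modnMDl.
Qed.

Lemma mulq_modm x : x * q ^ m = x %[mod n].
Proof. by rewrite -modnMmr -[m]add0n expq_mod expn0 modnMmr muln1. Qed.

Lemma expq_gt0 i : 0 < q ^ i. Proof. by rewrite expn_gt0; lia. Qed.

(** Neither part of the word cut at [j] is zero, since otherwise [x] or its rotation would be a
    multiple of [q]. Hence [q ^ (m - j)] and [q ^ j] are both at most [a]. *)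
Lemma rot_gap x j : 0 < j < m -> in_range x -> in_range ((x * q ^ j) %% n) ->
  m - k <= j <= k.
Proof.
move=> jm /andP[nx xa] /andP[nr ra].
have xn := leq_ltn_trans xa a_lt_n.
move: nr ra; rewrite rot_modE //; last by lia.
have E := divn_eq x (q ^ (m - j)).
move: E; set X := x %/ _; set Y := x %% _ => E nr ra.
have X0 : 0 < X.
  case: X nr {E ra} => // /negP[]; rewrite addn0 dvdn_mull //.
  by rewrite dvdn_exp //; lia.
have Y0 : 0 < Y.
  case: Y E {nr ra} => // E; case/negP: nx; rewrite E addn0 dvdn_mull //.
  by rewrite dvdn_exp //; lia.
have h1 : q ^ (m - j) < q ^ k.+1 by apply: leq_ltn_trans a_lt; nia.
have h2 : q ^ j < q ^ k.+1 by apply: leq_ltn_trans a_lt; nia.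
by move: h1 h2; rewrite !ltn_exp2l //; lia.
Qed.

(** By [rot_gap] two hits are at cyclic distance at least [m - k], and [k_small] says exactly that
    [m < 3 * (m - k)]. *)
Lemma hits_le2 y : \sum_(j < m) in_range ((y * q ^ j) %% n) <= 2.
Proof.
apply: (@sparse_sum_le2 m (m - k) (fun j => in_range ((y * q ^ j) %% n))).
  by lia.
move=> i j /andP[ij jm] hi hj.
have := @rot_gap ((y * q ^ i) %% n) (j - i) _ hi.
by rewrite modnMml -mulnA -expnD subnKC; [move=> /(_ _ hj); lia|lia].
Qed.

Lemma split_sum j : 0 < j < m ->
  \sum_(y < n) (in_range y && in_range ((y * q ^ j) %% n))
  = \sum_(0 <= t < q ^ m) \sum_(0 <= z < q ^ m) split_pair j t z.
Proof.
move=> jm.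
have qm : q ^ m = q ^ j * q ^ (m - j) by rewrite -expnD subnKC //; lia.
have ql := expq_gt0 (m - j); have qj := expq_gt0 j.
have le_j : q ^ j <= q ^ m by rewrite leq_exp2l //; lia.
have le_mj : q ^ (m - j) <= q ^ m by rewrite leq_exp2l //; lia.
have an := a_lt_n.
have t_big t z : q ^ j <= t -> split_pair j t z = false.
  move=> tj; apply/and4P => -[_ _ h _]; move: h an; rewrite qm; nia.
have z_big t z : q ^ (m - j) <= z -> split_pair j t z = false.
  move=> tj; apply/and4P => -[_ _ _ h]; move: h an; rewrite qm; nia.
rewrite (sum_widen le_j); last first.
  by move=> t tj; rewrite big1 // => z _; rewrite t_big.
have -> : \sum_(y < n) (in_range y && in_range ((y * q ^ j) %% n))
    = \sum_(0 <= y < q ^ m) (in_range y && in_range ((y * q ^ j) %% n)).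
  rewrite -(big_mkord xpredT
    (fun y => in_range y && in_range ((y * q ^ j) %% n) : nat)).
  rewrite -(@sum_widen _ n (q ^ m)) ?leq_subr // => y yn.
  by rewrite /in_range [y <= a]leqNgt (leq_trans an yn) andbF.
(* The range of [y] is cut into [q ^ j] blocks of length [q ^ (m - j)], so that
   [y = t * q ^ (m - j) + z]. *)
rewrite qm big_nat_mul /=; apply: eq_big_nat => t tj.
rewrite -qm (sum_widen le_mj) => [|z zj]; last by rewrite z_big.
rewrite mulSn addnC -{1}[t * q ^ (m - j)]add0n big_addn addKn.
apply: eq_big_nat => z zj; congr (nat_of_bool _).
have [taz|taz] := leqP (z + t * q ^ (m - j)) a; last first.
  have {}taz : (z + t * q ^ (m - j) <= a) = false by apply/negbTE; rewrite -ltnNge.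
  by rewrite /in_range /split_pair [t * _ + z]addnC taz !andbF.
rewrite /in_range taz andbT rot_modE; [|lia|lia].
have -> : (z + t * q ^ (m - j)) %% q ^ (m - j) = z by rewrite addnC modnMDl modn_small //; lia.
have -> : (z + t * q ^ (m - j)) %/ q ^ (m - j) = t.
  by rewrite addnC divnMDl ?divn_small ?addn0 //; lia.
rewrite /split_pair [t * _ + z]addnC taz /=.
rewrite dvdn_addl ?dvdn_mull ?dvdn_exp //; last by lia.
rewrite dvdn_addr ?dvdn_mull ?dvdn_exp //; last by lia.
by rewrite andbCA andbA.
Qed.

Lemma meets_range_count :
  2 * #|[set y : 'I_n | meets_range y]| + m * shift_sum split_pair
  = 2 * m * \sum_(0 <= x < q ^ m) in_range x.
Proof.
have an := a_lt_n.
have n0 : 0 < n by lia.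
pose s (y : 'I_n) : 'I_n := Ordinal (ltn_pmod (y * q) n0).
have sE j y : val (iter j s y) = (y * q ^ j) %% n.
  elim: j => [|j IHj] /=; first by rewrite muln1 modn_small.
  by rewrite IHj modnMml -mulnA expnSr.
have := @orbit_count 'I_n s m (fun y => in_range (val y)).
have -> : \sum_(0 <= x < q ^ m) in_range x = \sum_(y < n) in_range (val y).
  rewrite (@sum_widen _ n) ?leq_subr ?big_mkord // => x xn.
  by rewrite /in_range [x <= a]leqNgt (leq_trans an xn) andbF.
move=> <-.
- congr (2 * _ + m * _).
    apply: eq_card => y; rewrite !inE; apply: eq_existsb => j.
    by rewrite sE.
  apply: eq_big_nat => j jm; rewrite -split_sum //; apply: eq_bigr => y _.
  by rewrite sE.
- by lia.
- by move=> y; apply/val_inj; rewrite sE mulq_modm modn_small.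
- by move=> y; under eq_bigr do rewrite sE; apply: hits_le2.
Qed.

Lemma meets_range_mul y : y < n -> meets_range y -> meets_range ((y * q) %% n).
Proof.
move=> yn /existsP[[[|j] jm] /= h]; apply/existsP.
  (* A hit at exponent 0 is met again at [m.-1] once [y] is multiplied by [q], because [q ^ m] is 1
     modulo [n]. *)
  have mm : m.-1 < m by lia.
  exists (Ordinal mm) => /=.
  by rewrite modnMml -mulnA -expnS (ltn_predK m_gt2) mulq_modm -[y]muln1.
exists (Ordinal (ltnW jm)) => /=.
by rewrite modnMml -mulnA -expnS.
Qed.

(** Write [i = x * q ^ v] with [q] not dividing [x]; rotating [i] by [m - v] places gives [x], which
    lies in the range. *)
Lemma meets_range_small i : 0 < i <= a -> meets_range (i %% n).
Proof.
move=> /andP[i0 ia]; have an := a_lt_n.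
have [v [x [iE nx]]] : exists v x, i = x * q ^ v /\ ~~ (q %| x).
  elim/ltn_ind: i i0 {ia} => i IHi i0.
  have [/dvdnP[i' iE]|nq] := boolP (q %| i); last by exists 0, i; rewrite muln1.
  have i'0 : 0 < i' by move: i0; rewrite iE; case: (i').
  have [|v [x [xE nx]]] := IHi i' _ i'0; first by rewrite iE; nia.
  by exists v.+1, x; rewrite iE xE expnSr mulnA.
have x0 : 0 < x by move: i0; rewrite iE; case: (x).
have xi : x <= i by rewrite iE leq_pmulr // expq_gt0.
have xr : in_range x by rewrite /in_range nx (leq_trans xi).
have vm : v < m.
  have : q ^ v < q ^ m by apply: leq_ltn_trans (_ : i < _); rewrite ?iE; nia.
  by rewrite ltn_exp2l.
apply/existsP; case: v iE vm => [|v] iE vm.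
  exists (Ordinal (ltnW (ltnW m_gt2))) => /=.
  rewrite muln1 modn_mod modn_small ?iE ?expn0 ?muln1 //; lia.
have mv : m - v.+1 < m by lia.
exists (Ordinal mv) => /=.
rewrite modnMml iE -mulnA -expnD subnKC 1?ltnW // mulq_modm modn_small //; lia.
Qed.

Lemma meets_rangeP y : y < n -> meets_range y ->
  exists i j, 1 <= i <= a /\ y * q ^ j = i %[mod n].
Proof.
move=> yn /existsP[j /andP[nq ia]].
exists ((y * q ^ j) %% n), j; split; last by rewrite modn_mod.
by rewrite ia andbT lt0n; apply: contraNneq nq => ->.
Qed.

Lemma in_range_sum : \sum_(0 <= x < q ^ m) in_range x = a - a %/ q.
Proof. by apply: sum_nondvd; have := a_lt_n; lia. Qed.

End Cosets.

(** * Counting the pairs of rotations *)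

Section Symmetry.

Local Open Scope nat_scope.

Variables (q m : nat).
Hypotheses (q1 : 1 < q).

Local Notation shift_sum := (shift_sum q m).

Definition leading j t z := z * q ^ j <= t * q ^ (m - j).
Definition tied j t z := z * q ^ j == t * q ^ (m - j).

Lemma eq_shift_sum P Q : (forall j t z, 0 < j < m -> P j t z = Q j t z) ->
  shift_sum P = shift_sum Q.
Proof.
move=> PQ; apply: eq_big_nat => j jm.
by apply: eq_bigr => t _; apply: eq_bigr => z _; rewrite PQ.
Qed.

Lemma shift_sum_swap P : shift_sum (fun j t z => P (m - j) z t) = shift_sum P.
Proof.
rewrite /shift_sum big_nat_rev /=; apply: eq_big_nat => j jm.
rewrite exchange_big /=; apply: eq_bigr => t _; apply: eq_bigr => z _.
by congr (nat_of_bool (P _ _ _)); lia.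
Qed.

(** The swap reverses the inequality in [leading], so two copies of the leading triples cover [W]
    once and its tied triples a second time. *)
Lemma shift_sum_half (W : nat -> nat -> nat -> bool) :
  (forall j t z, 0 < j < m -> W (m - j) z t = W j t z) ->
  shift_sum W + shift_sum (fun j t z => W j t z && tied j t z)
  = 2 * shift_sum (fun j t z => W j t z && leading j t z).
Proof.
move=> Wsym; rewrite mul2n -addnn -{2}(shift_sum_swap (fun j t z => W j t z && leading j t z)).
rewrite -!big_split /=.
apply: eq_big_nat => j jm; rewrite -!big_split /=.
apply: eq_bigr => t _; rewrite -!big_split /=; apply: eq_bigr => z _.
rewrite Wsym // /tied /leading subKn; last by lia.
by case: (W _ _ _) => //; case: ltngtP.
Qed.

Lemma tied_eq j t z : 0 < j < m -> ~~ (q %| t) -> ~~ (q %| z) ->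
  tied j t z -> j = m - j.
Proof.
by move=> _ nt nz /eqP /(expn_factor_inj q1 nz nt).
Qed.

(** A tie between cofactors not divisible by [q] forces equal exponents, so [j = m - j] and then
    [t = z]; an odd [m] allows no such [j]. *)
Lemma shift_sum_tied (W : nat -> nat -> nat -> bool) : 0 < m ->
  (forall j t z, 0 < j < m -> W j t z -> ~~ (q %| t) && ~~ (q %| z)) ->
  shift_sum (fun j t z => W j t z && tied j t z)
  = if odd m then 0 else \sum_(0 <= t < q ^ m) W (m %/ 2) t t.
Proof.
move=> m0 Wnd.
have W0 j t z : 0 < j < m -> j <> m - j -> W j t z && tied j t z = false.
  move=> jm nj; apply/andP => -[Wj tj]; have /andP[nt nz] := Wnd _ _ _ jm Wj.
  exact: nj (tied_eq jm nt nz tj).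
have W0s j : 0 < j < m -> j <> m - j ->
  \sum_(0 <= t < q ^ m) \sum_(0 <= z < q ^ m) (W j t z && tied j t z) = 0.
  by move=> jm nj; rewrite big1 // => t _; rewrite big1 // => z _; rewrite W0.
case: ifPn => [modd|meven].
  rewrite /shift_sum big_nat big1 // => j jm; apply: W0s => //.
  by move: modd jm => /[swap] jm; lia.
have mh : 0 < m %/ 2 < m by lia.
rewrite /shift_sum (bigD1_seq (m %/ 2)) ?mem_index_iota ?iota_uniq //=.
rewrite [X in _ + X]big_seq_cond [X in _ + X]big1 ?addn0; last first.
  by move=> j /andP[]; rewrite mem_index_iota => jm nj; apply: W0s => //; lia.
apply: eq_big_nat => t /andP[_ tm].
rewrite -(@sum_pred1 _ t (fun z => W (m %/ 2) t z) tm); apply: eq_bigr => z _.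
rewrite /tied; have -> : m - m %/ 2 = m %/ 2 by lia.
by rewrite eqn_pmul2r ?expn_gt0 ?(ltnW q1) // andbC.
Qed.

End Symmetry.

(** * Sorting the leading triples by [t * q ^ (m - j)] *)

Section Decomposition.

Local Open Scope nat_scope.

Variables (q m a k : nat).
Hypotheses (q1 : 1 < q) (a_ge : q ^ k <= a) (a_lt : a < q ^ k.+1).
Hypotheses (m_gt2 : 2 < m) (k_small : 3 * k + 1 <= 2 * m).

Local Notation b := (m - k).
Local Notation shift_sum := (shift_sum q m).

Definition top_part := a %/ q ^ b * q ^ b.

Definition max_pair j t z :=
  [&& ~~ (q %| t), ~~ (q %| z), leading q m j t z & t * q ^ (m - j) + z <= a].

Definition low_pair j t z :=
  [&& ~~ (q %| t), ~~ (q %| z), z * q ^ j < q ^ k & t * q ^ (m - j) < q ^ k].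

Definition mid_pair j t z :=
  [&& ~~ (q %| t), ~~ (q %| z), leading q m j t z
    & q ^ k <= t * q ^ (m - j) < top_part].

Definition high_pair j t z :=
  [&& ~~ (q %| t), ~~ (q %| z), leading q m j t z,
      t * q ^ (m - j) == top_part & z <= a %% q ^ b].

Lemma top_partE : a = top_part + a %% q ^ b.
Proof. exact: divn_eq. Qed.

Lemma modb_lt : a %% q ^ b < q ^ b.
Proof. by rewrite ltn_mod expn_gt0 ltnW. Qed.

Lemma pos_nondvd x : ~~ (q %| x) -> 0 < x.
Proof. by case: x => //; rewrite dvdn0. Qed.

Lemma le_expk x i : ~~ (q %| x) -> x * q ^ i <= a -> i <= k.
Proof.
move=> /pos_nondvd x0 xa; have : q ^ i < q ^ k.+1.
  by apply: leq_ltn_trans a_lt; apply: leq_trans xa; rewrite leq_pmull.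
by rewrite ltn_exp2l // ltnS.
Qed.

(** From [i >= m - k] follows [b + i >= 2 * (m - k)], which is at least [k.+1] by [k_small]. *)
Lemma lt_expb x i : 0 < i < m -> m - i <= k -> x * q ^ i <= a -> x < q ^ b.
Proof.
move=> im ik xa; have : x * q ^ i < q ^ b * q ^ i.
  apply: (leq_ltn_trans xa); apply: (leq_trans a_lt).
  by rewrite -expnD leq_exp2l //; lia.
by rewrite ltn_pmul2r // expn_gt0 ltnW.
Qed.

Lemma dvd_expb x i : b <= i -> q ^ b %| x * q ^ i.
Proof. by move=> bi; rewrite dvdn_mull // dvdn_exp2l. Qed.

(** For leading triples the second inequality of [split_pair] follows from the first. A tie means
    [t = z], and both inequalities coincide. Otherwise [z * q ^ j] and [t * q ^ (m - j)] are
    distinct multiples of [q ^ b], so they differ by at least [q ^ b], which exceeds [t]. *)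
Lemma split_leading j t z : 0 < j < m ->
  split_pair q m a j t z && leading q m j t z = max_pair j t z.
Proof.
move=> jm; rewrite /split_pair /max_pair.
case nt: (q %| t) => //=; case nz: (q %| z) => //=.
case: (boolP (leading q m j t z)); rewrite ?andbF //= andbT => lead.
apply: andb_idr => pa.
have [E|strict] := eqVneq (z * q ^ j) (t * q ^ (m - j)).
  have jj : j = m - j by apply: (@tied_eq q m q1 j t z); rewrite ?nt ?nz // /tied E.
  move: E pa; rewrite -jj => /eqP; rewrite eqn_pmul2r ?expn_gt0 ?(ltnW q1) //.
  by move=> /eqP->.
have jk : j <= k by apply: (@le_expk z); rewrite ?nz //; rewrite /leading in lead; lia.
have mjk : m - j <= k by apply: (@le_expk t); rewrite ?nt //; lia.
have tb : t < q ^ b by apply: (@lt_expb t (m - j)); lia.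
have := @dvdn_gap (q ^ b) (z * q ^ j) (t * q ^ (m - j)).
rewrite !dvd_expb //; try lia.
rewrite ltn_neqAle strict /=; rewrite /leading in lead.
by move=> /(_ isT isT lead); lia.
Qed.

Lemma shift_sum_split :
  2 * shift_sum max_pair
  = shift_sum (split_pair q m a)
    + if odd m then 0
      else \sum_(0 <= t < q ^ m) (~~ (q %| t) && (t * q ^ (m %/ 2) + t <= a)).
Proof.
have <- : shift_sum (fun j t z => split_pair q m a j t z && leading q m j t z)
  = shift_sum max_pair by apply: eq_shift_sum => *; apply: split_leading.
rewrite -(shift_sum_half q1) => [|j t z jm]; last first.
  by rewrite /split_pair subKn; [rewrite andbCA; do 2!congr (_ && _); rewrite andbC|lia].
rewrite (shift_sum_tied q1); [|lia|by move=> j t z _ /and4P[-> ->]].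
congr (_ + _); case: ifPn => // meven; apply: eq_bigr => t _.
have E : m - m %/ 2 = m %/ 2 by lia.
by rewrite /split_pair E !andbA !andbb -!andbA andbb.
Qed.

Hypothesis k_big : m <= 2 * k.

Lemma top_part_ge : q ^ k <= top_part.
Proof.
have E : q ^ k = q ^ (k - b) * q ^ b by rewrite -expnD subnK //; lia.
by rewrite E leq_mul2r leq_divRL ?expn_gt0 ?(ltnW q1) // -E a_ge orbT.
Qed.

(** [p = t * q ^ (m - j)] is a multiple of [q ^ b] and [z < q ^ b]. So if [p] is below [q ^ k] or
    below [top_part], themselves multiples of [q ^ b], then [p + z <= a] is automatic. At
    [p = top_part] it bounds [z] by the erased digits, and a larger [p] would exceed [a]. *)
Lemma max_pairE j t z : 0 < j < m ->
  (max_pair j t z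
   = low_pair j t z && leading q m j t z + mid_pair j t z + high_pair j t z :> nat)%N.
Proof.
move=> jm; rewrite /max_pair /low_pair /mid_pair /high_pair.
case nt: (q %| t) => //=; case nz: (q %| z) => //=.
case: (boolP (leading q m j t z)); rewrite ?andbF //= => lead; rewrite andbT.
have topb : q ^ b %| top_part by rewrite dvdn_mull.
have jk : t * q ^ (m - j) <= a -> [/\ b <= m - j, m - j <= k & z < q ^ b].
  move=> pa; have jk : j <= k by apply: le_expk (leq_trans lead pa); rewrite nz.
  have mjk : m - j <= k by apply: le_expk pa; rewrite nt.
  split=> //; first by rewrite leq_sub2l.
  exact: lt_expb jm mjk (leq_trans lead pa).
have gap y : q ^ b %| y -> t * q ^ (m - j) < y -> t * q ^ (m - j) <= a ->
    t * q ^ (m - j) + z <= y.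
  move=> yb py /jk[bmj _ zb]; apply: leq_trans (dvdn_gap (dvd_expb t bmj) yb py).
  by rewrite leq_add2l ltnW.
have top_a : top_part <= a by rewrite {1}top_partE leq_addr.
have [pk|pk] /= := ltnP (t * q ^ (m - j)) (q ^ k).
  rewrite (leq_ltn_trans lead pk) (ltn_eqF (leq_trans pk top_part_ge)) /=.
  rewrite (leq_trans (gap _ (dvdn_exp2l _ _) pk (ltnW (leq_trans pk a_ge)))) //.
  by rewrite leq_subLR addnn -mul2n.
rewrite andbF /=; have [pt|pt] /= := ltnP (t * q ^ (m - j)) top_part.
  by rewrite (ltn_eqF pt) (leq_trans (gap _ topb pt (ltnW (leq_trans pt top_a)))).
have [->|ne] /= := eqVneq (t * q ^ (m - j)) top_part.
  by rewrite {1}top_partE leq_add2l.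
apply/eqP; rewrite eqb0; apply/negP => pa.
have {}pa := leq_trans (leq_addr _ _) pa; have [bmj _ _] := jk pa.
have lt_pt : top_part < t * q ^ (m - j) by rewrite ltn_neqAle eq_sym ne.
have := leq_trans (dvdn_gap topb (dvd_expb t bmj) lt_pt) pa.
by rewrite {1}top_partE leq_add2l leqNgt modb_lt.
Qed.

Lemma shift_sum_max :
  shift_sum max_pair
  = shift_sum (fun j t z => low_pair j t z && leading q m j t z)
    + shift_sum mid_pair + shift_sum high_pair.
Proof.
rewrite -!big_split /=; apply: eq_big_nat => j jm.
rewrite -!big_split; apply: eq_bigr => t _.
by rewrite -!big_split; apply: eq_bigr => z _; rewrite max_pairE.
Qed.

(** Such a [z] is a word of [k - j] digits whose last digit is nonzero and whose other digits are
    free. *)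
Lemma sum_below j : 0 < j <= m ->
  \sum_(0 <= z < q ^ m) (~~ (q %| z) && (z * q ^ j < q ^ k))
  = (j < k) * (q.-1 * q ^ (k - j).-1).
Proof.
move=> jm; have qj : 0 < q ^ j by rewrite expn_gt0 ltnW.
have [jk|jk] := ltnP j k; last first.
  rewrite big1 // => z _; case: (boolP (q %| z)) => // /pos_nondvd z0 /=.
  apply/eqP; rewrite eqb0 -leqNgt; apply: leq_trans (leq_pmull _ z0).
  by rewrite leq_exp2l.
have E : q ^ k = q ^ (k - j) * q ^ j by rewrite -expnD subnK // ltnW.
have qkj : 0 < q ^ (k - j) by rewrite expn_gt0 ltnW.
have qm : (q ^ (k - j)).-1 < q ^ m.
  by rewrite prednK //; rewrite leq_exp2l //; lia.
rewrite mul1n.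
have [p pE] : exists p, k - j = p.+1 by exists (k - j).-1; rewrite prednK // subn_gt0.
rewrite pE in E qm *; rewrite (eq_bigr (fun z => ~~ (q %| z) && (z <= (q ^ p.+1).-1) : nat)).
  rewrite sum_nondvd //; have qp : 0 < q ^ p by rewrite expn_gt0 ltnW.
  have -> : (q ^ p.+1).-1 = (q ^ p).-1 * q + q.-1 by rewrite expnSr; nia.
  rewrite divnMDl ?divn_small ?addn0; [|lia|lia].
  by rewrite /=; nia.
move=> z _; rewrite E ltn_pmul2r //; congr (nat_of_bool (_ && _)).
by rewrite -[RHS]ltnS prednK // expn_gt0 ltnW.
Qed.

(** For fixed [j] the conditions on [t] and [z] are independent. Both counts are nonzero only for
    [b < j < k], and their product does not depend on [j]. *)
Lemma shift_sum_low :
  shift_sum low_pair = (2 * k - m.+1) * (q.-1 ^ 2 * q ^ (2 * k - m - 2)).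
Proof.
transitivity (\sum_(1 <= j < m) (b.+1 <= j < k) * (q.-1 ^ 2 * q ^ (2 * k - m - 2))).
  apply: eq_big_nat => j jm.
  transitivity ((\sum_(0 <= t < q ^ m) (~~ (q %| t) && (t * q ^ (m - j) < q ^ k)))
     * (\sum_(0 <= z < q ^ m) (~~ (q %| z) && (z * q ^ j < q ^ k)))).
    rewrite big_distrl /=; apply: eq_bigr => t _.
    rewrite big_distrr /=; apply: eq_bigr => z _.
    rewrite mulnb /low_pair -!andbA; congr (nat_of_bool (_ && _)).
    by rewrite [RHS]andbC -!andbA.
  rewrite !sum_below; [|lia|lia].
  have [jk|jk] := ltnP j k; rewrite ?andbF ?muln0 // andbT mul1n.
  have -> : (m - j < k) = (b < j) by apply/idP/idP; lia.
  case: (ltnP b j) => // bj; rewrite !mul1n mulnACA mulnn -expnD.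
  by congr (_ * q ^ _); lia.
by rewrite -big_distrl /= sum_interval; [congr (_ * _)| |]; lia.
Qed.

Lemma shift_sum_low_leading :
  2 * shift_sum (fun j t z => low_pair j t z && leading q m j t z)
  = (2 * k - m.+1) * (q.-1 ^ 2 * q ^ (2 * k - m - 2))
    + if odd m then 0 else (m %/ 2 < k) * (q.-1 * q ^ (k - m %/ 2).-1).
Proof.
rewrite -shift_sum_low -(shift_sum_half q1) => [|j t z jm]; last first.
  rewrite /low_pair subKn; last by lia.
  by rewrite andbCA; do 2!congr (_ && _); rewrite andbC.
rewrite (shift_sum_tied q1); [|lia|by move=> j t z _ /and4P[-> ->]].
congr (_ + _); case: ifPn => // meven.
rewrite -sum_below; last by lia.
apply: eq_bigr => t _; have E : m - m %/ 2 = m %/ 2 by lia.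
by rewrite /low_pair E !andbA !andbb -!andbA andbb.
Qed.

(** The power of [q] in [top_part] determines [j] and then [t = c], so only [z] remains free;
    [leading] bounds it by [top_part %/ q ^ j]. *)
Lemma shift_sum_high j c : b <= j <= k -> ~~ (q %| c) ->
  top_part = c * q ^ (m - j) ->
  shift_sum high_pair
  = \sum_(0 <= z < q ^ m) (~~ (q %| z) && (z <= minn (a %% q ^ b) (top_part %/ q ^ j))).
Proof.
move=> jbk nc topE; have qj : 0 < q ^ j by rewrite expn_gt0 ltnW.
have jm : 0 < j < m by lia.
have topm : top_part < q ^ m.
  apply: leq_ltn_trans (_ : a < _); first by rewrite {1}top_partE leq_addr.
  by apply: leq_trans a_lt _; rewrite leq_exp2l //; lia.
have cm : c < q ^ m.
  by apply: leq_ltn_trans topm; rewrite topE leq_pmulr // expn_gt0 ltnW.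
have uniq_jt j' t : 0 < j' < m -> ~~ (q %| t) -> t * q ^ (m - j') = top_part ->
    j' = j /\ t = c.
  move=> j'm nt; rewrite topE => E; have h := expn_factor_inj q1 nt nc E.
  split; first by lia.
  by move/eqP: E; rewrite h eqn_pmul2r ?expn_gt0 ?(ltnW q1) // => /eqP.
rewrite /shift_sum (bigD1_seq j) ?mem_index_iota ?iota_uniq //=.
rewrite [X in _ + X]big_seq_cond [X in _ + X]big1 ?addn0; last first.
  move=> j' /andP[]; rewrite mem_index_iota => j'm jj'.
  rewrite big1 // => t _; rewrite big1 // => z _; apply/eqP; rewrite eqb0.
  apply/negP => /and5P[nt _ _ /eqP/uniq_jt[]// /eqP].
  by rewrite (negPf jj').
rewrite exchange_big /=; apply: eq_bigr => z _.
rewrite -(@sum_pred1 (q ^ m) c (fun=> ~~ (q %| z) && (z <= minn (a %% q ^ b) (top_part %/ q ^ j)))) //.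
apply: eq_bigr => t _; congr (nat_of_bool _).
have [->|tc] /= := eqVneq t c.
  rewrite /high_pair nc -topE eqxx /leading -topE leq_min leq_divRL //=.
  by congr (_ && _); rewrite andbC.
by apply/negP => /and5P[nt _ _ /eqP/uniq_jt[]// _ /eqP]; rewrite (negPf tc).
Qed.

End Decomposition.

(** * The functions f and g *)

Section RationalFormulas.

Variables (q a : nat).
Hypothesis q1 : (1 < q)%N.

Local Notation delta := a.+1.

Lemma q0 : q%:R != 0 :> rat.
Proof. by rewrite pnatr_eq0 -lt0n ltnW. Qed.

Lemma natr_exp (i : nat) : (q ^ i)%N%:R = q%:R ^ i :> rat.
Proof. by rewrite natrX. Qed.

Lemma exprq_gt0 (i : int) : 0 < q%:R ^ i :> rat.
Proof. by rewrite exprz_gt0 // ltr0n ltnW. Qed.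

Lemma Nq_nat (x : rat) (X : nat) : X%:R <= x < X.+1%:R ->
  Nq q (x + 1) = (X - X %/ q)%N%:Z.
Proof.
move=> /andP[x_ge x_lt]; have qr0 : 0 < q%:R :> rat by rewrite ltr0n ltnW.
have -> : Nq q (x + 1) = X%:Z - (X %/ q)%N%:Z.
  rewrite /Nq addrK; congr (_ - _); apply: floor_def.
    by rewrite -[X%:Z + 1]/(X + 1)%N%:Z addn1 -!pmulrn x_ge.
  rewrite -[_%:Z + 1]/(X %/ q + 1)%N%:Z addn1 -!pmulrn ler_pdivlMr // ltr_pdivrMr //.
  rewrite -!natrM (le_trans _ x_ge) ?ler_nat ?leq_divM //=.
  by rewrite (lt_le_trans x_lt) // ler_nat ltn_ceil // ltnW.
by rewrite -subzn // leq_div.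
Qed.

(** This is the meaning of [N] at [x + 1], also for fractional [x]: the number of positive integers
    up to [x] that [q] does not divide. Every term of f and g involving [N] is read this way. *)
Lemma Nq_sum (x : rat) (M : nat) : 0 <= x < M%:R ->
  (Nq q (x + 1))%:~R
  = (\sum_(0 <= z < M) (~~ (q %| z)%N && (z%:R <= x)%R))%:R :> rat.
Proof.
move=> /andP[x0 xM]; pose X := Num.truncn x.
have xX : X%:R <= x < X.+1%:R by apply: truncn_itv.
have XM : (X < M)%N by rewrite -(ltr_nat rat) (le_lt_trans _ xM) //; case/andP: xX.
rewrite (Nq_nat xX) -(sum_nondvd q XM) -pmulrn; congr (_%:R).
apply: eq_bigr => z _; congr (nat_of_bool (_ && _)).
apply/idP/idP => [zX|zx]; first by case/andP: xX => + _; apply: le_trans; rewrite ler_nat.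
by rewrite -ltnS -(ltr_nat rat) (le_lt_trans zx) //; case/andP: xX.
Qed.

Lemma digit_sum (x y : nat) : (x <= y)%N ->
  (a %% q ^ y = a %% q ^ x + \sum_(x <= l < y) digit q delta l * q ^ l)%N.
Proof.
elim: y => [|y IHy]; first by rewrite leqn0 => /eqP->; rewrite big_geq // addn0.
rewrite leq_eqVlt => /orP[/eqP->|xy]; first by rewrite big_geq ?addn0.
rewrite big_nat_recr //= addnA -IHy // /digit /=.
have qy : (0 < q ^ y)%N by rewrite expn_gt0 ltnW.
have E1 := divn_eq a (q ^ y); have E2 := divn_eq (a %/ q ^ y) q.
rewrite {1}E1 {1}E2 mulnDl -mulnA -expnS -addnA modnMDl modn_small 1?addnC //.
have := ltn_pmod a qy; have : (a %/ q ^ y %% q < q)%N by rewrite ltn_mod ltnW.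
by rewrite expnS; nia.
Qed.

Lemma dsumE (x y : nat) (c : int) : (x <= y)%N ->
  dsum q delta x (y%:Z - 1) c = (a %% q ^ y - a %% q ^ x)%N%:R / q%:R ^ c.
Proof.
move=> xy; rewrite (digit_sum xy) addKn /dsum.
have -> : \sum_(l <- zrange x (y%:Z - 1)) (digit q delta l)%:R * q%:R ^ (l - c)
  = \sum_(x <= l < y) (digit q delta l)%:R * q%:R ^ (l%:Z - c) :> rat.
  rewrite -(big_map Posz xpredT (fun l => (digit q delta l)%:R * q%:R ^ (l - c))).
  apply: perm_big; apply: uniq_perm; first exact: zrange_uniq.
    by rewrite map_inj_uniq ?iota_uniq // => i j [].
  move=> l; rewrite mem_zrange; apply/idP/mapP => [xl|[i]].
    by exists `|l|%N; rewrite ?mem_index_iota; lia.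
  by rewrite mem_index_iota; lia.
rewrite natr_sum mulr_suml; apply: eq_bigr => l _.
by rewrite natrM natr_exp expfzDr ?q0 // mulrA invr_expz.
Qed.

Lemma dsum_low (y : nat) : dsum q delta 0 (y%:Z - 1) 0 = (a %% q ^ y)%N%:R.
Proof. by rewrite (@dsumE 0) // expn0 modn1 subn0 expr0z divr1. Qed.

End RationalFormulas.

(** * Matching the counts with the formulas *)

Section Theorem3.

Variables (q m a k : nat).
Hypotheses (q1 : (1 < q)%N) (a_ge : (q ^ k <= a)%N) (a_lt : (a < q ^ k.+1)%N).
Hypotheses (m_gt2 : (2 < m)%N) (k_small : (3 * k + 1 <= 2 * m)%N).

Local Notation b := (m - k)%N.
Local Notation h := (m %/ 2)%N.
Local Notation delta := a.+1.

Lemma lt_exp_log i : (a < q ^ i)%N = (k < i)%N.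
Proof.
apply/idP/idP => [ai|ki]; last by rewrite (leq_trans a_lt) // leq_exp2l.
by rewrite -(ltn_exp2l _ _ q1) (leq_ltn_trans a_ge).
Qed.

(** A leading triple has both [q ^ j] and [q ^ (m - j)] at most [a], so [j] and [m - j] are at most
    [k]. *)
Lemma shift_sum_max0 : (2 * k < m)%N -> shift_sum q m (max_pair q m a) = 0%N.
Proof.
move=> km; rewrite /shift_sum big_nat big1 // => j jm.
rewrite big1 // => t _; rewrite big1 // => z _.
apply/eqP; rewrite eqb0; apply/negP => /and4P[nt nz lead pa].
have {}pa := leq_trans (leq_addr _ _) pa.
have := le_expk q1 a_lt nt pa; have := le_expk q1 a_lt nz (leq_trans lead pa).
by lia.
Qed.

Hypothesis kE : trunc_log q a = k.

Lemma kdE : kd q m delta = k%:Z - h%:Z.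
Proof. by rewrite /kd /= kE. Qed.

Lemma dsum_top (x : nat) (c : int) : (x <= k.+1)%N ->
  dsum q delta x k c = (a %/ q ^ x * q ^ x)%N%:R / q%:R ^ c.
Proof.
move=> xk; have -> : k%:Z = k.+1%:Z - 1 by lia.
rewrite (dsumE _ q1) // (modn_small a_lt); congr (_%:R / _).
by rewrite {1}(divn_eq a (q ^ x)) addnK.
Qed.

Lemma dsum_shift (x : nat) : (x <= k.+1)%N -> dsum q delta x k x = (a %/ q ^ x)%N%:R.
Proof.
by move=> xk; rewrite dsum_top // natrM natr_exp mulfK // lt0r_neq0 // (exprq_gt0 q1).
Qed.

Definition diag_count : nat :=
  \sum_(0 <= t < q ^ m) (~~ (q %| t)%N && (t * q ^ h + t <= a)%N).

Lemma tauE : (h <= k)%N ->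
  tau q m delta = ~~ (q %| a %/ q ^ h)%N && (a %/ q ^ h <= a %% q ^ h)%N.
Proof.
move=> hk; rewrite /tau /hm kdE.
have -> : h%:Z + (k%:Z - h%:Z) = k by lia.
rewrite dsum_shift ?leqW // (dsum_low _ q1) ler_nat.
by rewrite /digit /= lt0n.
Qed.

(** With [a = c * q ^ h + r] and [c < q ^ h], the inequality [t * q ^ h + t <= a] holds for [t < c],
    fails for [t > c], and at [t = c] amounts to [c <= r], the case recorded by [tau]. *)
Lemma diag_countE : ~~ odd m -> (h <= k)%N ->
  diag_count%:R = (Nq q ((a %/ q ^ h)%N%:R : rat))%:~R + (tau q m delta)%:R :> rat.
Proof.
move=> meven hk; rewrite tauE // /diag_count.
set c := (a %/ q ^ h)%N; set r := (a %% q ^ h)%N.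
have qh : (0 < q ^ h)%N by rewrite expn_gt0 ltnW.
have aE : a = (c * q ^ h + r)%N := divn_eq a (q ^ h).
have r_lt : (r < q ^ h)%N by rewrite ltn_mod.
have c0 : (0 < c)%N by rewrite divn_gt0 // (leq_trans _ a_ge) // leq_exp2l.
have c_lt : (c < q ^ h)%N.
  rewrite ltn_divLR // -expnD (leq_trans a_lt) // leq_exp2l //; lia.
have cm : (c < q ^ m)%N by rewrite (leq_trans c_lt) // leq_exp2l // leq_div.
have -> : (\sum_(0 <= t < q ^ m) (~~ (q %| t) && (t * q ^ h + t <= a)) =
    \sum_(0 <= t < q ^ m) (~~ (q %| t) && (t <= c.-1)) +
    \sum_(0 <= t < q ^ m) ((t == c) && (~~ (q %| t) && (t <= r))))%N.
  rewrite -big_split /=; apply: eq_bigr => t _.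
  case: (q %| t)%N => /=; first by rewrite andbF.
  rewrite -[(t <= c.-1)%N]ltnS prednK //.
  have [tc|tc|->] := ltngtP t c; rewrite ?addn0 /=.
  - have : (t.+1 * q ^ h <= c * q ^ h)%N by rewrite leq_mul2r tc orbT.
    by rewrite mulSn => tq; apply/eqP; rewrite eqb1; lia.
  - have : (c.+1 * q ^ h <= t * q ^ h)%N by rewrite leq_mul2r tc orbT.
    by rewrite mulSn => tq; apply/eqP; rewrite eqb0; lia.
  by rewrite [in LHS]aE leq_add2l.
rewrite sum_nondvd ?sum_pred1 ?(leq_ltn_trans (leq_pred _)) // natrD; congr (_ + _).
have -> : c%:R = c.-1%:R + 1 :> rat by rewrite -[X in X%:R = _](prednK c0) -addn1 natrD.
by rewrite (@Nq_nat q q1 _ c.-1) // lexx ltr_nat /=.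
Qed.

Lemma g_evenE : ~~ odd m -> g_even q m delta = diag_count%:R.
Proof.
move=> meven; rewrite /g_even lt_exp_log.
case: ifPn => [kh|]; last first.
  rewrite -leqNgt => hk; rewrite diag_countE // addn1 lt_exp_log.
  rewrite /hm kdE.
  have -> : h%:Z + (k%:Z - h%:Z) = k by lia.
  rewrite (dsum_shift (leqW hk)); have [kh|//] := ltnP k h.+1; congr (_ + _).
  (* Here [c = a %/ q ^ h] is a single digit, so no multiple of [q] is removed and [N] of [c] is
     [c - 1]. *)
  have hk' : k = h by lia.
  have c_lt : (a %/ q ^ h < q)%N.
    by rewrite ltn_divLR ?expn_gt0 ?(ltnW q1) // -expnS -hk'.
  have c0 : (0 < a %/ q ^ h)%N by rewrite divn_gt0 ?expn_gt0 ?(ltnW q1) // -hk'.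
  rewrite /digit /= modn_small //; move: (a %/ q ^ h)%N c0 c_lt => c c0 c_lt.
  have cE : c%:R = c.-1%:R + 1 :> rat by rewrite -[X in X%:R = _](prednK c0) -addn1 natrD.
  rewrite {2}cE (@Nq_nat q q1 _ c.-1) ?lexx ?ltr_nat //=.
  by rewrite divn_small ?subn0 ?cE ?addrK // (leq_ltn_trans (leq_pred _)).
rewrite /diag_count big1 // => t _; apply/eqP; rewrite eqb0.
apply/negP => /andP[nt ta].
by have := le_expk q1 a_lt nt (leq_trans (leq_addr _ _) ta); rewrite leqNgt kh.
Qed.

Section LargeRange.

Hypothesis k_big : (m <= 2 * k)%N.

Local Notation top := (top_part q m a k).

(** [v] is the position of the lowest nonzero digit of [a] at or above position [b]. The digits from
    [b] to [v - 1] vanish, so cutting [a] at [v] or at [b] leaves the same top part, and [v] is the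
    exact power of [q] in it. *)
Lemma sd_spec : exists v, [/\ sd q m delta = v%:Z - h%:Z, (b <= v <= k)%N,
  (a %% q ^ v = a %% q ^ b)%N, ~~ (q %| a %/ q ^ v)%N & (a %/ q ^ v * q ^ v = top)%N].
Proof.
have [||] := @sdP q m delta q1.
- by rewrite ltnS; apply: leq_trans a_ge; rewrite expn_gt0 ltnW.
- by rewrite kdE /hm; lia.
rewrite kdE /hm; set s := sd _ _ _ => s_in s_dig s_min.
pose v := absz (h%:Z + s)%R.
have vE : h%:Z + s = v by rewrite /v; lia.
have v_in : (b <= v <= k)%N by lia.
have modv : (a %% q ^ v = a %% q ^ b)%N.
  rewrite (digit_sum (x := b) (y := v) _ q1) ?big1_seq ?addn0 //; last by case/andP: v_in.
  move=> l; rewrite mem_index_iota => /= lbv; apply/eqP; rewrite muln_eq0.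
  apply/orP; left; rewrite eqn0Ngt; apply/negP => dl.
  have := s_min (l%:Z - h%:Z); rewrite [h%:Z + _]addrC subrK.
  by move=> /(_ _ dl); lia.
exists v; split=> //; first by lia.
  by move: s_dig; rewrite vE /digit /= lt0n.
by apply/eqP; rewrite -(eqn_add2r (a %% q ^ v)) -divn_eq modv -top_partE.
Qed.

(** The index of the set is [i = m - h - j], for which [h + i = m - j]; multiplying its bounds by
    [q ^ (m - j)] gives integers. *)
Lemma mem_Tset_nat (j t : nat) : (j <= m)%N ->
  (t%:Z \in Tset q m delta (m%:Z - h%:Z - j%:Z))
  = [&& ~~ (q %| t)%N, (q ^ k <= t * q ^ (m - j))%N & (t * q ^ (m - j) < top)%N].
Proof.
move=> jm; rewrite mem_Tset ?(ltnW q1) // kdE.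
have [v [sE /andP[_ vk] _ _ topE]] := sd_spec.
have -> : hm m + sd q m delta = v by rewrite sE /hm; lia.
have -> : hm m + (k%:Z - h%:Z) = k by rewrite /hm; lia.
have -> : hm m + (m%:Z - h%:Z - j%:Z) = (m - j)%N by rewrite /hm; lia.
have -> : k%:Z - h%:Z - (m%:Z - h%:Z - j%:Z) = k%:Z - (m - j)%N%:Z by lia.
rewrite dsum_top ?leqW // topE expfzDr ?(q0 q1) // -invr_expz.
rewrite ler_pdivrMr ?(exprq_gt0 q1) // ltr_pdivlMr ?(exprq_gt0 q1) //.
rewrite -!natr_exp -pmulrn -!natrM ler_nat ltr_nat andbC.
by congr (_ && _).
Qed.

Lemma Nq_leading (j t : nat) : (0 < j < m)%N -> (t * q ^ (m - j) <= a)%N ->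
  (Nq q (t%:~R * q%:R ^ (m%:Z - 2 * j%:Z) + 1 : rat))%:~R
  = (\sum_(0 <= z < q ^ m) (~~ (q %| z)%N && leading q m j t z))%:R :> rat.
Proof.
move=> jm ta.
have -> : t%:~R * q%:R ^ (m%:Z - 2 * j%:Z) = (t * q ^ (m - j))%N%:R / q%:R ^ j :> rat.
  have -> : m%:Z - 2 * j%:Z = (m - j)%N%:Z - j%:Z by lia.
  by rewrite expfzDr ?(q0 q1) // -invr_expz natrM natr_exp mulrA -pmulrn.
have qj : 0 < q%:R ^ j :> rat := exprq_gt0 q1 _.
rewrite (@Nq_sum _ q1 _ (q ^ m)) => [|]; last first.
  rewrite divr_ge0 ?ler0n ?ltW //= ltr_pdivrMr // -natr_exp -natrM ltr_nat.
  apply: (leq_ltn_trans ta); have := a_lt_n q1 a_ge a_lt m_gt2 k_small.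
  by have := expn_gt0 q j; rewrite (ltnW q1) /=; nia.
congr (_%:R); apply: eq_bigr => z _; congr (nat_of_bool (_ && _)).
by rewrite ler_pdivlMr // -natr_exp -natrM ler_nat.
Qed.

(** Both parities are treated at once: [m - 2h] is 1 or 0, which gives the exponents [2i - 1] and
    [2i]. The substitution [i = m - h - j] turns the range of [i] into [b <= j <= k]. *)
Lemma sum_Tset :
  \sum_(i <- zrange (m%:Z - 2 * h%:Z - kd q m delta) (kd q m delta))
    \sum_(t <- Tset q m delta i)
      (Nq q (t%:~R * q%:R ^ (2 * i - (m%:Z - 2 * h%:Z)) + 1 : rat))%:~R
  = (shift_sum q m (mid_pair q m a k))%:R :> rat.
Proof.
have top_a : (top <= a)%N by rewrite [X in (_ <= X)%N](top_partE q m a k) leq_addr.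
pose G (i : int) : rat := \sum_(t <- Tset q m delta i)
  (Nq q (t%:~R * q%:R ^ (2 * i - (m%:Z - 2 * h%:Z)) + 1 : rat))%:~R.
transitivity (\sum_(1 <= j < m | (b <= j <= k)%N) G (m%:Z - h%:Z - j%:Z)).
  rewrite -[RHS]big_filter -[RHS](big_map (fun j : nat => m%:Z - h%:Z - j%:Z) xpredT G).
  apply: perm_big; apply: uniq_perm; first exact: zrange_uniq.
    by rewrite map_inj_uniq ?filter_uniq ?iota_uniq // => i j; lia.
  move=> i; rewrite kdE mem_zrange; apply/idP/mapP => [i_in|[j]].
    by exists (absz (m%:Z - h%:Z - i)%R); rewrite ?mem_filter ?mem_index_iota; lia.
  by rewrite mem_filter mem_index_iota; lia.
rewrite /shift_sum natr_sum big_mkcond; apply: eq_big_nat => j jm.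
(* Outside [b <= j <= k] there are no mid triples, since [leading] forces both [j] and [m - j] to be
   at most [k]. *)
case: ifPn => [jbk|njbk]; last first.
  rewrite big1 // => t _; rewrite big1 // => z _.
  apply/eqP; rewrite eqb0; apply/negP => /and4P[nt nz lead /andP[_ pt]].
  have pa : (t * q ^ (m - j) <= a)%N by rewrite (leq_trans (ltnW pt)).
  have := le_expk q1 a_lt nt pa.
  have := le_expk q1 a_lt nz (leq_trans lead pa).
  by lia.
rewrite /G; have jm' : (j <= m)%N by lia.
transitivity (\sum_(0 <= t < q ^ m | t%:Z \in Tset q m delta (m%:Z - h%:Z - j%:Z))
    (Nq q (t%:Z%:~R * q%:R ^ (m%:Z - 2 * j%:Z) + 1 : rat))%:~R : rat).
  have -> : m%:Z - 2 * j%:Z = 2 * (m%:Z - h%:Z - j%:Z) - (m%:Z - 2 * h%:Z) by lia.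
  rewrite -[RHS]big_filter -[RHS](big_map Posz xpredT (fun t : int => (Nq q (t%:~R * q%:R ^
    (2 * (m%:Z - h%:Z - j%:Z) - (m%:Z - 2 * h%:Z)) + 1 : rat))%:~R)).
  apply: perm_big; apply: uniq_perm; first exact: Tset_uniq.
    by rewrite map_inj_uniq ?filter_uniq ?iota_uniq // => x y [].
  move=> t; apply/idP/mapP => [t_in|[x]]; last by rewrite mem_filter => /andP[+ _] ->.
  have [x tx] : exists x : nat, t = x.
    exists `|t|%N; move: t_in; rewrite mem_Tset ?(ltnW q1) // => /andP[/andP[+ _] _].
    move=> /(lt_le_trans (exprq_gt0 q1 _)); rewrite ltr0z; lia.
  exists x => //; rewrite mem_filter -tx t_in mem_index_iota /=.
  move: t_in; rewrite tx mem_Tset_nat // => /and3P[_ _ xt].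
  have := a_lt_n q1 a_ge a_lt m_gt2 k_small.
  have : (0 < q ^ (m - j))%N by rewrite expn_gt0 ltnW.
  by nia.
rewrite big_mkcond natr_sum; apply: eq_bigr => t _.
rewrite mem_Tset_nat // /mid_pair; case nt: (q %| t)%N => /=.
  by rewrite big1.
case: ifPn => [/andP[pk pt]|pkt]; last first.
  by rewrite big1 // => z _; rewrite !andbF.
rewrite Nq_leading ?(leq_trans (ltnW pt)) //; congr (_%:R).
by apply: eq_bigr => z _; rewrite andbT.
Qed.

Lemma Nq_mu (v : nat) : (b <= v <= k)%N -> (a %/ q ^ v * q ^ v = top)%N ->
  ~~ (q %| a %/ q ^ v)%N ->
  (Nq q (Num.min (dsum q delta 0 (b%:Z - 1) 0)
                 (dsum q delta (m - v)%N k (m - v)%N) + 1))%:~R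
  = (shift_sum q m (high_pair q m a k))%:R :> rat.
Proof.
move=> vbk topE nc.
have mv : (b <= m - v <= k)%N by lia.
rewrite (@shift_sum_high _ _ _ _ q1 a_ge a_lt m_gt2 k_small k_big _ _ mv nc); last first.
  by rewrite subKn; [rewrite topE|lia].
rewrite (dsum_low _ q1) dsum_shift; last by lia.
(* Since [b <= m - v], erasing the [b] lowest digits does not affect the quotient. *)
have -> : (top %/ q ^ (m - v) = a %/ q ^ (m - v))%N.
  have E : (q ^ (m - v) = q ^ b * q ^ (m - v - b))%N by rewrite -expnD subnKC //; lia.
  by rewrite E !divnMA mulnK // expn_gt0 ltnW.
set u := (a %% q ^ b)%N; set w := (a %/ q ^ (m - v))%N.
have -> : Num.min u%:R w%:R = (minn u w)%:R :> rat.
  by rewrite minEle ler_nat /minn; case: ltngtP => // ->.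
rewrite (@Nq_sum _ q1 _ (q ^ m)); last first.
  rewrite ler0n ltr_nat gtn_min; apply/orP; left.
  rewrite /u; apply: leq_trans (_ : q ^ b <= _)%N; first by rewrite ltn_mod expn_gt0 ltnW.
  by rewrite leq_exp2l // leq_subr.
by congr (_%:R); apply: eq_bigr => z _; rewrite ler_nat.
Qed.


End LargeRange.

(** Here [b = k], so [j = k] is the only shift and [leading] reads [z <= t]. The triples are the
    pairs [1 <= z <= t < c], and as [c < q] none of these numbers is a multiple of [q]. *)
Lemma shift_sum_mid_half : m = (2 * k)%N ->
  (2 * shift_sum q m (mid_pair q m a k) = (a %/ q ^ k).-1 * (a %/ q ^ k))%N.
Proof.
move=> mE; set c := (a %/ q ^ k)%N.
have qk : (0 < q ^ k)%N by rewrite expn_gt0 ltnW.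
have topE : top_part q m a k = (c * q ^ k)%N.
  by rewrite /top_part; have -> : (m - k = k)%N by lia.
have top_a : (top_part q m a k <= a)%N by rewrite topE leq_divM.
have c_lt : (c < q)%N by rewrite ltn_divLR // -expnS.
have qm : (q <= q ^ m)%N by rewrite -[X in (X <= _)%N]expn1 leq_exp2l //; lia.
have nd x : (0 < x < q)%N -> ~~ (q %| x)%N by move=> /andP[x0 xq]; rewrite gtnNdvd.
have midE j t z : (0 < j < m)%N ->
    mid_pair q m a k j t z = (j == k) && ((1 <= t < c)%N && (1 <= z < t.+1)%N).
  move=> jm; apply/idP/idP.
    move=> /and4P[nt nz lead /andP[pk pt]]; have pa := leq_trans (ltnW pt) top_a.
    have j1 := le_expk q1 a_lt nt pa.
    have j2 := le_expk q1 a_lt nz (leq_trans lead pa).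
    have jk : j = k by lia.
    move: lead pt; rewrite jk eqxx /leading; have -> : (m - k = k)%N by lia.
    rewrite topE leq_pmul2r // ltn_pmul2r // => zt tc.
    by rewrite ltnS zt tc !(@pos_nondvd q).
  move=> /and3P[/eqP-> /andP[t0 tc] /andP[z0 zt]].
  rewrite /mid_pair /leading topE; have -> : (m - k = k)%N by lia.
  rewrite leq_pmul2r // ltn_pmul2r // leq_pmull // tc -ltnS zt.
  by rewrite !nd //; lia.
have -> : shift_sum q m (mid_pair q m a k) = (\sum_(0 <= t < c) t)%N.
  transitivity (\sum_(1 <= j < m) ((j == k) * \sum_(0 <= t < q ^ m)
      \sum_(0 <= z < q ^ m) ((1 <= t < c) && (1 <= z < t.+1))))%N.
    apply: eq_big_nat => j jm; rewrite big_distrr /=; apply: eq_bigr => t _.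
    by rewrite big_distrr /=; apply: eq_bigr => z _; rewrite midE // mulnb.
  rewrite -big_distrl /= (_ : \sum_(1 <= j < m) (j == k) = 1)%N; last first.
    rewrite (eq_bigr (fun j => (k <= j < k.+1)%N : nat)).
      by rewrite sum_interval ?subSnn //; lia.
    by move=> j _; rewrite ltnS eqn_leq andbC.
  rewrite mul1n (@sum_widen _ c) ?(leq_trans (ltnW c_lt)) // => [|t tc]; last first.
    by rewrite big1 // => z _; rewrite [(t < c)%N]ltnNge tc andbF.
  apply: eq_big_nat => t /andP[_ tc].
  transitivity ((0 < t) * \sum_(0 <= z < q ^ m) (1 <= z < t.+1))%N.
    by rewrite big_distrr /=; apply: eq_bigr => z _; rewrite mulnb tc andbT.
  rewrite sum_interval //; last by lia.
  by rewrite subn1 /=; case: (t) => // t'; rewrite mul1n.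
by rewrite bin2_sum -mul_bin_diag bin1 mulnC.
Qed.

Lemma natr_pred : (q.-1)%:R = q%:R - 1 :> rat.
Proof. by rewrite -[in RHS](prednK (ltnW q1)) -addn1 natrD addrK. Qed.

Lemma natr_double_inj (x : rat) (y : nat) : 2 * x = (2 * y)%N%:R -> x = y%:R.
Proof. by rewrite natrM; apply: mulfI. Qed.

Lemma f_oddE : odd m -> f_odd q m delta = (shift_sum q m (max_pair q m a))%:R.
Proof.
move=> modd; rewrite /f_odd addn1 lt_exp_log.
case: ifPn => [kh|]; first by rewrite shift_sum_max0 //; lia.
rewrite -leqNgt => hk; have k_big : (m <= 2 * k)%N by lia.
have [v [sE vbk _ nv topE]] := sd_spec k_big.
rewrite (shift_sum_max q1 a_ge a_lt m_gt2 k_small k_big) !natrD.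
rewrite -(sum_Tset k_big) -(Nq_mu k_big vbk topE nv).
rewrite -[RHS]addrA [X in _ = _ + X]addrC addrA; congr (_ + _ + _).
- apply: natr_double_inj.
  rewrite (shift_sum_low_leading q1 a_ge a_lt m_gt2 k_small k_big) modd addn0.
  have kdK : kd q m delta = (k - h.+1)%N%:Z + 1 by rewrite kdE; clear -hk; lia.
  rewrite kdK addrK -pmulrn.
  have -> : (2 * k - m.+1 = 2 * (k - h.+1))%N by clear -modd hk; lia.
  (* For [k = h.+1] both sides vanish through a zero factor. This case is separated because the
     exponent [2 * kd - 3] is then negative while [2 * k - m - 2] is truncated. *)
  case KE: (k - h.+1)%N => [|K]; first by rewrite mulr0 mul0r mulr0 mul0n.
  have -> : (2 * k - m - 2 = (2 * K).+1)%N by clear -KE modd hk; lia.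
  have -> : 2 * (K.+1%:Z + 1) - 3 = (2 * K).+1%:Z by clear; lia.
  rewrite !natrM !natrX natr_pred -natr_exp natrX; ring.
- congr (Nq q (_ + 1))%:~R; rewrite /mu_odd sE kdE /hm.
  (* For odd [m], the bound [hm - kd] is [b - 1] and [hm - sd + 1] is [m - v]. *)
  by congr (Num.min (dsum _ _ _ _ _) (dsum _ _ _ _ _)); clear -modd hk vbk k_small; lia.
have E : m%:Z - 2 * h%:Z = 1 by clear -modd; lia.
rewrite E [1 - _]addrC; apply: eq_bigr => i _; apply: eq_bigr => t _.
by [].
Qed.

Lemma f_evenE : ~~ odd m -> f_even q m delta = (shift_sum q m (max_pair q m a))%:R.
Proof.
move=> meven; rewrite /f_even lt_exp_log.
case: ifPn => [kh|]; first by rewrite shift_sum_max0 //; lia.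
rewrite -leqNgt => hk; have k_big : (m <= 2 * k)%N by lia.
have [v [sE vbk _ nv topE]] := sd_spec k_big.
have muE : mu_even q m delta = Num.min (dsum q delta 0 (b%:Z - 1) 0)
                 (dsum q delta (m - v)%N k (m - v)%N).
  rewrite /mu_even sE kdE /hm.
  by congr (Num.min (dsum _ _ _ _ _) (dsum _ _ _ _ _)); clear -meven hk vbk k_small; lia.
rewrite muE (Nq_mu k_big vbk topE nv).
rewrite (shift_sum_max q1 a_ge a_lt m_gt2 k_small k_big) !natrD addn1 lt_exp_log.
have low2 := shift_sum_low_leading q1 a_ge a_lt m_gt2 k_small k_big.
rewrite (negPf meven) in low2.
case: ifPn => kh.
  (* Here [kd = 0]: there are no low triples, and the mid triples alone give the binomial term in
     the digit at position [h]. *)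
  have kE' : k = h by clear -hk kh; lia.
  have mE : m = (2 * k)%N by clear -kE' meven; lia.
  have low0 : shift_sum q m (fun j t z => low_pair q m k j t z && leading q m j t z) = 0%N.
    have k0 : (2 * k - m.+1 = 0)%N by clear -mE; lia.
    by apply/eqP; move: low2; rewrite -kE' ltnn k0 /= => /eqP; rewrite muln_eq0.
  rewrite low0 add0r; congr (_ + _); apply: natr_double_inj.
  rewrite shift_sum_mid_half // /digit /hm /= kE'.
  have c_lt : (a %/ q ^ h < q)%N by rewrite ltn_divLR ?expn_gt0 ?(ltnW q1) // -expnS -kE'.
  have c0 : (0 < a %/ q ^ h)%N by rewrite divn_gt0 ?expn_gt0 ?(ltnW q1) // -kE'.
  rewrite modn_small // natrM; move: (a %/ q ^ h)%N c0 => c c0.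
  have -> : c%:R = c.-1%:R + 1 :> rat by rewrite -[X in X%:R = _](prednK c0) -addn1 natrD.
  by field.
rewrite -(sum_Tset k_big) -[RHS]addrA [X in _ = _ + X]addrC addrA; congr (_ + _ + _).
  apply: natr_double_inj; rewrite low2.
  have h_lt : (h < k)%N by rewrite ltnNge.
  have kdK : kd q m delta = (k - h.+1)%N%:Z + 1 by rewrite kdE; clear -h_lt; lia.
  have -> : (2 * k - m.+1 = 2 * (k - h.+1) + 1)%N by clear -h_lt meven; lia.
  have -> : (2 * k - m - 2 = 2 * (k - h.+1))%N by clear -h_lt meven; lia.
  rewrite h_lt -subnS kdK; move: (k - h.+1)%N => K; rewrite addrK.
  have -> : 2 * (K%:Z + 1) - 2 = (2 * K)%N%:Z by clear; lia.
  rewrite mul1n natrD !natrM natrD !natrX natr_pred -!natr_exp !natrX rmorphD /= natrM -pmulrn.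
  by field.
have E : m%:Z - 2 * h%:Z = 0 by clear -meven; lia.
rewrite E sub0r; apply: eq_bigr => i _; apply: eq_bigr => t _.
by rewrite subr0.
Qed.

(** The relation [2 |U| + m |D| = 2 m |A|] is combined with [|D| = 2 f - g], where f is still the
    count of [max_pair] and g is [diag_count]. *)
Lemma card_meets_range :
  #|[set y : 'I_(q ^ m - 1) | meets_range q m a y]|%:R
  = m%:R * ((Nq q (delta%:R : rat))%:~R - (shift_sum q m (max_pair q m a))%:R)
    + (if odd m then 0 else m%:R / 2 * diag_count%:R) :> rat.
Proof.
have := meets_range_count q1 a_ge a_lt m_gt2 k_small.
have := shift_sum_split q1 a_ge a_lt m_gt2 k_small.
rewrite (in_range_sum q1 a_ge a_lt m_gt2 k_small) -/diag_count.
have -> : (Nq q (delta%:R : rat))%:~R = (a - a %/ q)%N%:R :> rat.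
  by rewrite -addn1 natrD (@Nq_nat q q1 _ a) // lexx ltr_nat /=.
move: (shift_sum _ _ _) (shift_sum _ _ _) (a - a %/ q)%N #|_| => S V N U VS US.
have {US} := congr1 (fun x : nat => x%:R : rat) US.
have {VS} := congr1 (fun x : nat => x%:R : rat) VS.
rewrite !(natrD, natrM) => VS US.
apply: (mulfI (x := 2)) => //; rewrite mulrDr.
have -> : 2 * U%:R = 2 * m%:R * N%:R - m%:R * S%:R :> rat by rewrite -US; ring.
have -> : S%:R = 2 * V%:R - (if odd m then 0 else diag_count)%N%:R :> rat.
  by rewrite VS; case: ifP => _; ring.
by case: ifP => _; field.
Qed.

End Theorem3.

Theorem theorem3 (q m delta : nat) (F : finFieldType) (L : fieldExtType F)
    (alpha : L) :
  #|F| = q ->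
  (4 <= m)%N ->
  \dim {:L} = m ->
  (q ^ m - 1).-primitive_root alpha ->
  (2 <= delta <= q ^ ((2 * m - 1) %/ 3 + 1))%N ->
  let n := (q ^ m - 1)%N in
  (odd m ->
    (\dim (bch_code alpha n delta))%:R
    = n%:R - m%:R * ((Nq q (delta%:R : rat))%:~R - f_odd q m delta)) /\
  (~~ odd m ->
    (\dim (bch_code alpha n delta))%:R
    = n%:R - m%:R * ((Nq q (delta%:R : rat))%:~R - f_even q m delta)
      - m%:R / 2 * g_even q m delta).
Proof.
move=> cardF m4 _ prim delta_in n.
have q1 : (1 < q)%N by rewrite -cardF finNzRing_gt1.
have [a aE] : exists a, delta = a.+1 by exists delta.-1; lia.
have a0 : (0 < a)%N by lia.
have [k kE] : exists k, trunc_log q a = k by exists (trunc_log q a).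
have /andP[a_ge a_lt] := trunc_log_bounds q1 a0; rewrite kE in a_ge a_lt.
have m2 : (2 < m)%N by lia.
(* [q ^ k <= a < delta] and the upper bound on [delta] give [k <= (2 * m - 1) %/ 3]. *)
have k_small : (3 * k + 1 <= 2 * m)%N.
  have : (q ^ k < q ^ ((2 * m - 1) %/ 3 + 1))%N by apply: leq_ltn_trans a_ge _; lia.
  by rewrite ltn_exp2l //; lia.
rewrite aE; have dimE : (\dim (bch_code alpha n a.+1))%:R
    = n%:R - #|[set y : 'I_n | meets_range q m a y]|%:R :> rat.
  rewrite -[X in X%:R - _](@dim_bch_code F L alpha n a.+1 (meets_range q m a) prim).
  - by rewrite natrD addrK.
  - by move=> y yn; rewrite cardF; exact: meets_range_mul q1 a_ge a_lt m2 k_small y yn.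
  - by move=> i; rewrite ltnS; exact: meets_range_small q1 a_ge a_lt m2 k_small i.
  - by move=> y yn; rewrite cardF; exact: meets_rangeP yn.
rewrite dimE (card_meets_range q1 a_ge a_lt m2 k_small); split=> modd.
  by rewrite modd addr0 (f_oddE q1 a_ge a_lt m2 k_small kE modd).
rewrite (negPf modd) (f_evenE q1 a_ge a_lt m2 k_small kE modd).
by rewrite (g_evenE q1 a_ge a_lt m2 k_small kE modd) opprD addrA.
Qed.
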